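(* Let $0<\theta_1\le\theta_2<\pi/2$, $\omega_1\in(0,1/2]$, and $\omega_2\in\big[\cos\theta_2(\cos\theta_1)^{-1}\omega_1,\,1/2\big]$. Then \[ E_k(\mathsf{F}_{\omega_1,\theta_1})\le E_k(\mathsf{F}_{\omega_2,\theta_2}) \] holds for all $k\in\mathbb{N}=\{1,2,\dots\}$.
   Context: For $\theta\in(0,\pi/2)$ let \[ \mathsf{Gui}(\theta)=\Big\{(r,z)\in(0,+\infty)\times\mathbb{R} : -\tfrac{\pi}{\sin\theta}<z,\ \max(0,z\tan\theta)<r<z\tan\theta+\tfrac{\pi}{\cos\theta}\Big\}, \] $\mathsf{Lay}(\theta)=\mathsf{Gui}(\theta)\times\mathbb{S}^1$ and $L^2_{\mathsf{cyl}}(\mathsf{Lay}(\theta))=L^2(\mathsf{Gui}(\theta)\times\mathbb{S}^1;r\,dr\,dz\,d\phi)$. For a constant $\omega\in(0,1/2]$ let $Q_{\omega,\theta}$ be the closure in $L^2_{\mathsf{cyl}}(\mathsf{Lay}(\theta))$ of the closable form \[ u\mapsto\int_{\mathsf{Lay}(\theta)}\Big(|\partial_r u|^2+|\partial_z u|^2+\frac{|i\partial_\phi u-\omega u|^2}{r^2}\Big)\,r\,dr\,dz\,d\phi,\qquad u\in\mathcal{C}^\infty_0(\mathsf{Lay}(\theta)). \] Let $(\pi^{[0]}u)(r,z)=(2\pi)^{-1/2}\int_0^{2\pi}u(r,z,\phi)\,d\phi$. The axisymmetric fiber $\mathsf{F}_{\omega,\theta}$ is the self-adjoint operator in $L^2(\mathsf{Gui}(\theta);r\,dr\,dz)$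 associated via the first representation theorem with the closed, densely defined, non-negative quadratic form \[ \mathfrak{f}_{\omega,\theta}[u]=\int_{\mathsf{Gui}(\theta)}\Big(|\partial_r u|^2+|\partial_z u|^2+\frac{\omega^2}{r^2}|u|^2\Big)r\,dr\,dz,\qquad \mathrm{dom}\,\mathfrak{f}_{\omega,\theta}=\pi^{[0]}(\mathrm{dom}\,Q_{\omega,\theta}). \] For a semi-bounded self-adjoint operator $\mathsf{T}$ with associated quadratic form $\mathfrak{t}$, the $k$-th Rayleigh quotient is \[ E_k(\mathsf{T})=\sup_{u_1,\dots,u_{k-1}\in\mathrm{dom}\,\mathfrak{t}}\ \inf_{\substack{u\in\mathrm{span}(u_1,\dots,u_{k-1})^\perp\\ u\in\mathrm{dom}\,\mathfrak{t}\setminus\{0\}}}\frac{\mathfrak{t}[u]}{\|u\|^2}. \] *)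

(* Defs.v *)
From HB Require Import structures.
From mathcomp Require Import all_boot all_order all_algebra.
From mathcomp Require Import complex.
From mathcomp Require Import all_classical all_reals all_analysis.

Set Implicit Arguments.
Unset Strict Implicit.
Unset Printing Implicit Defensive.

Import Order.TTheory GRing.Theory Num.Theory numFieldNormedType.Exports.

Local Open Scope classical_set_scope.
Local Open Scope ring_scope.
Local Open Scope complex_scope.

Definition cnorm2 (R : realType) (c : R[i]) : R := ComplexField.Normc.normc c ^+ 2.

Definition cderive (R : realType) (V : normedModType R) (u : V -> R[i])
    (v x : V) : R[i] :=
  'D_v (fun y => complex.Re (u y)) x +i* 'D_v (fun y => complex.Im (u y)) x.

Fixpoint class_C (R : realType) (V : normedModType R) (n : nat) (f : V -> R)
    : Prop :=
  continuous f /\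
  if n is m.+1 then
    (forall x v : V, derivable f x v) /\ (forall v : V, class_C m ('D_v f))
  else True.

Definition smooth (R : realType) (V : normedModType R) (u : V -> R[i]) : Prop :=
  forall n, class_C n (fun x => complex.Re (u x)) /\ class_C n (fun x => complex.Im (u x)).

Definition cmeasurable d (T : measurableType d) (R : realType) (D : set T)
    (u : T -> R[i]) : Prop :=
  measurable_fun D (fun x => complex.Re (u x)) /\ measurable_fun D (fun x => complex.Im (u x)).

(* Junk unless the real and imaginary parts of u are integrable on D. *)
Definition cintegral d (T : measurableType d) (R : realType)
    (mu : {measure set T -> \bar R}) (D : set T) (u : T -> R[i]) : R[i] :=
  (\int[mu]_(x in D) complex.Re (u x)) +i* (\int[mu]_(x in D) complex.Im (u x)).

(* The weighted space L^2(D; w dmu).  Its elements are represented by functions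
   on the whole of T, of which only the values on D matter. *)
Definition sqnorm d (T : measurableType d) (R : realType)
    (mu : {measure set T -> \bar R}) (D : set T) (w : T -> R)
    (u : T -> R[i]) : \bar R :=
  (\int[mu]_(x in D) (w x * cnorm2 (u x))%:E)%E.

Definition L2 d (T : measurableType d) (R : realType)
    (mu : {measure set T -> \bar R}) (D : set T) (w : T -> R)
    : set (T -> R[i]) :=
  [set u | cmeasurable D u /\ (sqnorm mu D w u < +oo)%E].

Definition inner d (T : measurableType d) (R : realType)
    (mu : {measure set T -> \bar R}) (D : set T) (w : T -> R)
    (u v : T -> R[i]) : R[i] :=
  cintegral mu D (fun x => (w x)%:C * (conjc (u x) * v x)).

(* A quadratic form is given by its domain and its graph: [form u y] means that
   y is the value of the form at u. *)
Definition rayleigh (T : Type) (R : realType) (dom : set (T -> R[i]))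
    (form : (T -> R[i]) -> \bar R -> Prop)
    (ip : (T -> R[i]) -> (T -> R[i]) -> R[i]) (k : nat) : \bar R :=
  ereal_sup [set b | exists us : 'I_k.-1 -> T -> R[i],
    (forall j, dom (us j)) /\
    b = ereal_inf [set q | exists (u : T -> R[i]) (y : \bar R),
          [/\ dom u,
              complex.Re (ip u u) != 0,
              forall c : 'I_k.-1 -> R[i],
                ip (fun x => \sum_(j < k.-1) c j * us j x) u = 0,
              form u y
            & q = (y * ((complex.Re (ip u u))^-1)%:E)%E]]].

(* Points of R^2 are (r, z). *)
Definition Gui (R : realType) (theta : R) : set (R * R) :=
  [set x | [/\ 0 < x.1,
               - (pi / sin theta) < x.2,
               Num.max 0 (x.2 * tan theta) < x.1
             & x.1 < x.2 * tan theta + pi / cos theta]].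

(* Points of R^3 are ((r, z), phi).  The circle is R / 2 pi Z; functions on
   Lay theta are integrated over this fundamental domain. *)
Definition Lay (R : realType) (theta : R) : set (R * R * R) :=
  [set p | Gui theta p.1 /\ 0 <= p.2 < 2 * pi].

Definition leb2 (R : realType) :=
  (@lebesgue_measure R \x @lebesgue_measure R)%E.

Definition leb3 (R : realType) :=
  (@lebesgue_measure R \x @lebesgue_measure R \x @lebesgue_measure R)%E.

Definition L2Gui (R : realType) (theta : R) : set (R * R -> R[i]) :=
  L2 (@leb2 R) (Gui theta) (fun x => x.1).

Definition L2cyl (R : realType) (theta : R) : set (R * R * R -> R[i]) :=
  L2 (@leb3 R) (Lay theta) (fun p => p.1.1).

Definition innerGui (R : realType) (theta : R) (u v : R * R -> R[i]) : R[i] :=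
  inner (@leb2 R) (Gui theta) (fun x => x.1) u v.

(* Test functions are extended by 0 outside of the open set. *)
Definition test_Gui (R : realType) (theta : R) : set (R * R -> R[i]) :=
  [set eta | smooth eta /\
    exists K : set (R * R), [/\ compact K, K `<=` Gui theta &
      forall x, ~ K x -> eta x = 0]].

(* As the circle is compact, a function on Lay theta has compact support iff it
   vanishes off K x S^1 for some compact subset K of Gui theta. *)
Definition test_Lay (R : realType) (theta : R) : set (R * R * R -> R[i]) :=
  [set u | [/\ smooth u,
    forall x phi, u (x, phi + 2 * pi) = u (x, phi) &
    exists K : set (R * R), [/\ compact K, K `<=` Gui theta &
      forall x phi, ~ K x -> u (x, phi) = 0]]].

Definition q0 (R : realType) (omega theta : R) (u : R * R * R -> R[i])
    : \bar R :=
  (\int[@leb3 R]_(p in Lay theta)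
    ((cnorm2 (cderive u (1, 0, 0) p) + cnorm2 (cderive u (0, 1, 0) p)
      + cnorm2 ((0 +i* 1)%C * cderive u (0, 0, 1) p - omega%:C * u p) / p.1.1 ^+ 2)
     * p.1.1)%:E)%E.

(* Domain of the closure of q0 on test_Lay: the L^2-limits of q0-Cauchy
   sequences of test functions. *)
Definition domQ (R : realType) (omega theta : R) : set (R * R * R -> R[i]) :=
  [set u | L2cyl theta u /\
    exists un : nat -> R * R * R -> R[i],
    [/\ forall n, test_Lay theta (un n),
        (fun n => sqnorm (@leb3 R) (Lay theta) (fun p => p.1.1)
                    (fun p => un n p - u p)) @ \oo --> 0%E
      & forall e : R, 0 < e -> exists N : nat, forall n m : nat,
          (N <= n)%N -> (N <= m)%N ->
          (q0 omega theta (fun p => un n p - un m p)%R < e%:E)%E]].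

Definition pi0 (R : realType) (u : R * R * R -> R[i]) (x : R * R) : R[i] :=
  ((Num.sqrt (2 * pi))^-1)%:C *
  cintegral (@lebesgue_measure R) `[0, 2 * pi[ (fun phi => u (x, phi)).

Definition domf (R : realType) (omega theta : R) : set (R * R -> R[i]) :=
  [set v | L2Gui theta v /\
    exists2 u, domQ omega theta u &
      {ae @leb2 R, forall x, Gui theta x -> v x = pi0 u x}].

Definition L1loc_Gui (R : realType) (theta : R) (u : R * R -> R[i]) : Prop :=
  cmeasurable (Gui theta) u /\
  forall K : set (R * R), compact K -> K `<=` Gui theta ->
    (\int[@leb2 R]_(x in K) (ComplexField.Normc.normc (u x))%:E < +oo)%E.

Definition weak_derivative (R : realType) (theta : R) (e : R * R)
    (u g : R * R -> R[i]) : Prop :=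
  [/\ L1loc_Gui theta u, L1loc_Gui theta g &
      forall eta, test_Gui theta eta ->
        cintegral (@leb2 R) (Gui theta) (fun x => u x * cderive eta e x)
        = - cintegral (@leb2 R) (Gui theta) (fun x => g x * eta x)].

(* Graph of the form f_(omega, theta).  The functions in domf have weak
   derivatives gr and gz, which are unique almost everywhere, so that y exists
   and does not depend on their choice. *)
Definition form_f (R : realType) (omega theta : R) (u : R * R -> R[i])
    (y : \bar R) : Prop :=
  exists gr gz : R * R -> R[i],
  [/\ weak_derivative theta (1, 0) u gr,
      weak_derivative theta (0, 1) u gz
    & y = (\int[@leb2 R]_(x in Gui theta)
             ((cnorm2 (gr x) + cnorm2 (gz x)
               + omega ^+ 2 / x.1 ^+ 2 * cnorm2 (u x)) * x.1)%:E)%E].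

(* The Rayleigh quotients of the fiber F_(omega, theta), expressed through the
   closed quadratic form that defines this operator. *)
Definition E_F (R : realType) (omega theta : R) (k : nat) : \bar R :=
  rayleigh (domf omega theta) (form_f omega theta) (innerGui theta) k.

(* Main.v *)
Require Import Defs.
From HB Require Import structures.
From mathcomp Require Import all_boot all_order all_algebra.
From mathcomp Require Import all_classical all_reals all_analysis.
From mathcomp Require Import complex measurable_realfun ring lra.

Set Implicit Arguments.
Unset Strict Implicit.
Unset Printing Implicit Defensive.

Import Order.TTheory GRing.Theory Num.Theory numFieldNormedType.Exports.
Local Open Scope classical_set_scope.
Local Open Scope ring_scope.

(** The comparison rests on one linear change of variables.  With
    [s = z cos th + r sin th] and [t = r cos th - z sin th], the guide is
    [{0 < t < pi, 0 < r}], and [r / cos th = s tan th + t].  Hence the linear map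
    that preserves [t] and [r / cos th] sends the guide of opening [theta1] onto
    the guide of opening [theta2].  In the coordinates [s tan th] and [t] the
    quotient to be compared reads, up to a constant factor common to the form
    and to the norm, with [x = s tan th],
      [tan^2 th |u_x|^2 + |u_t|^2 + (omega / cos th)^2 |u|^2 / (x + t)^2]
    against [|u|^2], with the weight [x + t] in both integrals: it is
    nondecreasing in [tan th] and in [omega / cos th].  In the coordinates
    [(r, z)] the map is lower triangular, [(r, z) |-> (c r, al r + be z)] with
    [c = cos theta2 / cos theta1], and the monotonicity of the gradient part is
    the contraction inequality [trig_contraction].

    Three things have to be transported along such a map [M].
    - Integrals: [M] multiplies Lebesgue measure by a constant, so that
      [integral_scaling] applies to arbitrary functions.
    - Weak derivatives and the form: [weak_derivative_comp], [form_comp_le].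
      The chain rule for test functions needs directional derivatives to be
      linear in the direction, which [derive_lin] derives from their continuity.
    - The form domain, which is defined by projecting the closure of the
      magnetic form of the three-dimensional layer, with the flux [omega] in it.
      Approximating test functions are composed with [M x id].  The estimate
      that keeps them Cauchy, [q0_comp_le], has to replace one flux by another.
      It follows from the bound
        [int |u|^2 <= C int |i u' - omega u|^2]
      for [2 pi]-periodic [u] and [0 < omega <= 1/2], which is
      [poincare_twisted]: the gauge transform [exp (i omega phi) u] has a
      derivative of modulus [|i u' - omega u|] and is multiplied by
      [exp (2 pi i omega)], a number different from [1], along a period.

    The trial subspaces for [theta1] are then carried over to [theta2] by [M^-1],
    and every admissible [u] for [theta2] gives an admissible [u o M] for
    [theta1] with a smaller quotient: [E_F_comp_le]. *)

(** The product Borel structures on [R^2] and [R^3]. *)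
Local Notation mR2 R := (measurableTypeR R * measurableTypeR R)%type.
Local Notation mR3 R := (measurableTypeR R * measurableTypeR R * measurableTypeR R)%type.

Local Notation normc := ComplexField.Normc.normc.

(** * Change of variables without measurability *)

Section scaling.
Context d (X : measurableType d) (R : realType).
Variable m : {measure set X -> \bar R}.

(** [T] multiplies the measure by [k] under preimage: for an invertible linear
    map, [k] is the inverse of the absolute value of the determinant. *)
Definition scales (T : X -> X) (k : R) :=
  forall A, measurable A -> m (T @^-1` A) = (k%:E * m A)%E.

Import HBNNSimple.

Lemma sintegral_scaling (T : X -> X) k (h : {nnsfun X >-> R}) :
  0 < k -> scales T k ->
  sintegral m (h \o T) = (k%:E * sintegral m h)%E.
Proof.
move=> k0 Tk; rewrite /sintegral ge0_mule_fsumr; last exact: nnsfun_mulemu_ge0.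
apply: eq_fsbigr => x _.
by rewrite comp_preimage Tk// muleCA.
Qed.

(** One half of the change of variables, without measurability of [f]: a simple
    function [h] below [f] gives the simple function [a *: (h \o T)] below the
    other integrand. *)
Lemma le_scaling_nnintegral (T : X -> X) (k a : R) (f : X -> \bar R) :
  measurable_fun setT T -> 0 < k -> 0 < a -> scales T k ->
  (forall x, 0 <= f x)%E ->
  ((a * k)%:E * \int[m]_x f x <= \int[m]_x (a%:E * f (T x)))%E.
Proof.
move=> mT k0 a0 Tk f0.
have ak0 : 0 < a * k by rewrite mulr_gt0.
rewrite muleC -lee_pdivlMr// [leLHS]ge0_integralTE//.
apply: ge_ereal_sup => _ [h /= hf <-].
rewrite lee_pdivlMr// muleC ge0_integralTE; last first.
  by move=> x; rewrite mule_ge0// lee_fin ltW.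
have mh : measurable_fun setT (h \o T) by exact: measurableT_comp.
have fh : finite_set (range (h \o T)).
  by apply: (@sub_finite_set _ _ (range h)) => [_ [x _ <-]|]; [exists (T x)|exact: fimfunP].
have h0 x : 0 <= (h \o T) x by exact: fun_ge0.
pose i1 := @isMeasurableFun.Build _ _ _ _ (h \o T) mh.
pose i2 := @FiniteImage.Build _ _ (h \o T) fh.
pose i3 := @isNonNegFun.Build _ _ (h \o T) h0.
pose hT : {nnsfun X >-> R} := HB.pack (h \o T) i1 i2 i3.
apply: ereal_sup_ubound => /=; exists (scale_nnsfun hT (ltW a0)) => /=.
  by move=> x; rewrite EFinM lee_pmul2l.
rewrite (_ : sintegral m _ = sintegral m (cst a \* hT))// sintegralrM.
by rewrite (@sintegral_scaling T k h)// muleA EFinM.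
Qed.

Variables (T T' : X -> X) (k : R).
Hypotheses (mT : measurable_fun setT T) (mT' : measurable_fun setT T').
Hypotheses (TK : cancel T T') (T'K : cancel T' T).
Hypotheses (k0 : 0 < k) (Tk : scales T k).

Lemma scales_inv : scales T' k^-1.
Proof.
move=> A mA; have mTA : measurable (T' @^-1` A) by rewrite -[X in measurable X]setTI;
  exact: mT'.
have -> : m A = (k%:E * m (T' @^-1` A))%E.
  rewrite -Tk//; congr (m _); apply/seteqP; split => x /=; by rewrite TK.
by rewrite muleA -EFinM mulVf ?gt_eqF// mul1e.
Qed.

Lemma ge0_integralT_scaling a (f : X -> \bar R) : 0 < a -> (forall x, 0 <= f x)%E ->
  (\int[m]_x (a%:E * f (T x)) = (a * k)%:E * \int[m]_x f x)%E.
Proof.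
move=> a0 f0; apply/eqP; rewrite eq_le le_scaling_nnintegral// andbT.
have af0 x : (0 <= a%:E * f (T x))%E by rewrite mule_ge0// lee_fin ltW.
have ki : 0 < k^-1 by rewrite invr_gt0.
have ai : 0 < a^-1 by rewrite invr_gt0.
have := le_scaling_nnintegral mT' ki ai scales_inv af0.
under [X in (_ <= X)%E -> _]eq_integral => x _ do
  rewrite T'K muleA -EFinM mulVf ?gt_eqF// mul1e.
by rewrite muleC -lee_pdivlMr ?mulr_gt0// -invfM invrK muleC.
Qed.

Lemma EFin_pmuleBr (c : R) (x y : \bar R) : 0 < c -> (c%:E * (x - y) = c%:E * x - c%:E * y)%E.
Proof.
move=> c0; case: x => [x||]; case: y => [y||] //=;
  rewrite ?gt0_muleNy ?gt0_muley ?lte_fin//=.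
by rewrite -!EFinM -EFinB mulrBr.
Qed.

(** Neither [f] nor [D] is assumed to be measurable; the integral of a signed
    function is the difference of the integrals of its two parts, with
    [+oo - +oo = -oo]. *)
Lemma integral_scaling a D (f : X -> \bar R) : 0 < a ->
  (\int[m]_(x in T @^-1` D) (a%:E * f (T x)) = (a * k)%:E * \int[m]_(x in D) f x)%E.
Proof.
move=> a0; rewrite integral_mkcond [in RHS]integral_mkcond integralE [in RHS]integralE.
have ak0 : 0 < a * k by rewrite mulr_gt0.
rewrite EFin_pmuleBr// -!ge0_integralT_scaling//.
have E : (fun x => a%:E * f (T x))%E \_ (T @^-1` D) = (fun x => a%:E * (f \_ D) (T x))%E.
  apply/funext => x; rewrite !patchE; have -> : (x \in T @^-1` D) = (T x \in D)
    by apply/idP/idP; rewrite !inE.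
  by case: ifP; rewrite ?mule0.
rewrite E; congr (_ - _)%E; apply: eq_integral => x _.
- by rewrite !funeposE maxe_pMr ?mule0// lee_fin ltW.
- by rewrite !funenegE maxe_pMr ?mule0 ?muleN// lee_fin ltW.
Qed.

Lemma fine_pmule (c : R) (x : \bar R) : 0 < c -> fine (c%:E * x)%E = c * fine x.
Proof.
by move=> c0; case: x => [x||] //=; rewrite ?gt0_muleNy ?gt0_muley ?lte_fin//= mulr0.
Qed.

Lemma Rintegral_scaling a D (f : X -> R) : 0 < a ->
  \int[m]_(x in T @^-1` D) (a * f (T x)) = a * k * \int[m]_(x in D) f x.
Proof.
move=> a0; rewrite /Rintegral.
by under eq_integral do rewrite EFinM; rewrite (integral_scaling _ (EFin \o f))//
  fine_pmule// mulr_gt0.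
Qed.

End scaling.

(** * Triangular linear maps *)

Section affine.
Context (R : realType).
Notation mu := (@lebesgue_measure R).

Lemma measurable_affine (a b : R) :
  measurable_fun setT (fun y : measurableTypeR R => a * y + b : measurableTypeR R).
Proof. by apply: measurable_funD => //; apply: measurable_funM. Qed.

Lemma lebesgue_scales (a b : R) : 0 < a -> scales mu (fun y => a * y + b) a^-1.
Proof.
move=> a0 A mA; have ai : 0 <= a by exact: ltW.
pose T : measurableTypeR R -> measurableTypeR R := fun y => a * y + b.
have mT : measurable_fun setT T := measurable_affine a b.
pose nu : {measure set (measurableTypeR R) -> \bar R} := mscale (NngNum ai) (pushforward mu T).
have E : mu A = nu mT A.
  apply: lebesgue_measure_unique => // _ [[x y] _ <-] /=.
  rewrite /nu /mscale /= /pushforward /=.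
  have -> : T @^-1` `]x, y]%classic = `]((x - b) / a), ((y - b) / a)]%classic.
    by apply/seteqP; split => z /=; rewrite !in_itv/= /T ltr_pdivrMr// ler_pdivlMr// ltrBlDr
      lerBrDr mulrC.
  rewrite !lebesgue_measure_itv/= !lte_fin ltr_pM2r ?invr_gt0// ltrD2r.
  case: ifP => _; last by rewrite mule0.
  rewrite -!EFinB -EFinM; congr (_%:E); field; by rewrite gt_eqF.
transitivity (a^-1%:E * nu mT A)%E; last by congr (_ * _)%E; exact: esym.
by rewrite /nu /mscale /= muleA -EFinM mulVf ?gt_eqF// mul1e.
Qed.
End affine.

Section skew.
Context d1 d2 (X : measurableType d1) (Y : measurableType d2) (R : realType).
Variables (m1 : {measure set X -> \bar R}) (m2 : {sigma_finite_measure set Y -> \bar R}).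
Local Open Scope ereal_scope.

(** A skew product scales the product measure by the product of the factors. *)
Lemma skew_scales (T T' : X -> X) (S : X -> Y -> Y) (k1 k2 : R) :
  measurable_fun setT T -> measurable_fun setT T' -> cancel T T' -> cancel T' T ->
  measurable_fun setT (fun p : X * Y => (T p.1, S p.1 p.2)) ->
  (0 < k1)%R -> (0 < k2)%R ->
  scales m1 T k1 -> (forall x, scales m2 (S x) k2) ->
  scales (m1 \x m2) (fun p => (T p.1, S p.1 p.2)) (k1 * k2).
Proof.
move=> mT mT' TK T'K mTS k10 k20 Tk Sk A mA.
rewrite /product_measure1 /= [(k1 * k2)%R]mulrC.
rewrite -(ge0_integralT_scaling mT mT' TK T'K k10 Tk k20)//.
apply: eq_integral => x _ /=.
rewrite -(Sk x); last exact: measurable_xsection.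
by congr (m2 _); apply/seteqP; split=> y /= /xsectionP ?; apply/xsectionP.
Qed.
End skew.

Section maps.
Context (R : realType).
Implicit Types (c al be : R).

(** The linear maps of the [(r, z)]-plane that are lower triangular, and their
    extension by the identity to the angular variable. *)
Definition trimap c al be (x : R * R) : R * R := (c * x.1, al * x.1 + be * x.2).
Definition trimapS c al be (p : R * R * R) : R * R * R := (trimap c al be p.1, p.2).

Lemma measurable_trimap c al be :
  measurable_fun setT (trimap c al be : mR2 R -> mR2 R).
Proof.
apply/measurable_fun_pair => /=.
  by apply: measurable_funM.
by apply: measurable_funD; apply: measurable_funM.
Qed.

Lemma measurable_trimapS c al be :
  measurable_fun setT (trimapS c al be : mR3 R -> mR3 R).
Proof.
apply/measurable_fun_pair => //=.
by apply: measurableT_comp => //; exact: measurable_trimap.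
Qed.

Lemma trimap_scales c al be : 0 < c -> 0 < be ->
  scales (@leb2 R) (trimap c al be) (c^-1 * be^-1).
Proof.
move=> c0 b0.
have H := @skew_scales _ _ (measurableTypeR R) (measurableTypeR R) R (@lebesgue_measure R)
  (@lebesgue_measure R)
  (fun y => c * y + 0) (fun y => c^-1 * y + 0) (fun x y => be * y + al * x) c^-1 be^-1.
rewrite (_ : trimap c al be = fun p => (c * p.1 + 0, be * p.2 + al * p.1)); last first.
  by apply/funext => p; rewrite /trimap addr0 addrC.
apply: H; rewrite ?invr_gt0//.
- exact: measurable_affine.
- exact: measurable_affine.
- by move=> x /=; rewrite !addr0 mulKf ?gt_eqF.
- by move=> x /=; rewrite !addr0 mulVKf ?gt_eqF.
- rewrite (_ : (fun _ => _) = trimap c al be); first exact: measurable_trimap.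
  by apply/funext => p; rewrite /trimap addr0 addrC.
- exact: lebesgue_scales.
- by move=> x; exact: lebesgue_scales.
Qed.

(** The inverses, for [c] and [be] nonzero. *)
Definition triinv c al be : R * R -> R * R := trimap c^-1 (- (al / (c * be))) be^-1.
Definition triinvS c al be : R * R * R -> R * R * R := trimapS c^-1 (- (al / (c * be))) be^-1.

Lemma trimapK c al be : 0 < c -> 0 < be -> cancel (trimap c al be) (triinv c al be).
Proof.
move=> c0 b0 [x y]; rewrite /triinv /trimap /=; congr pair; field; by rewrite ?gt_eqF.
Qed.
Lemma triinvK c al be : 0 < c -> 0 < be -> cancel (triinv c al be) (trimap c al be).
Proof.
move=> c0 b0 [x y]; rewrite /triinv /trimap /=; congr pair; field; by rewrite ?gt_eqF.
Qed.
Lemma trimapSK c al be : 0 < c -> 0 < be -> cancel (trimapS c al be) (triinvS c al be).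
Proof. by move=> c0 b0 [x y]; rewrite /triinvS /trimapS/=; congr pair; exact: trimapK. Qed.
Lemma triinvSK c al be : 0 < c -> 0 < be -> cancel (triinvS c al be) (trimapS c al be).
Proof. by move=> c0 b0 [x y]; rewrite /triinvS /trimapS/=; congr pair; exact: triinvK. Qed.

Lemma trimapS_scales c al be : 0 < c -> 0 < be ->
  scales (@leb3 R) (trimapS c al be) (c^-1 * be^-1).
Proof.
move=> c0 b0; rewrite -[c^-1 * be^-1]mulr1.
have H := @skew_scales _ _ (mR2 R) (measurableTypeR R) R
  (@lebesgue_measure R \x @lebesgue_measure R)%E (@lebesgue_measure R) (trimap c al be)
    (triinv c al be) (fun _ => id) (c^-1 * be^-1) 1.
apply: H => //.
- exact: measurable_trimap.
- exact: measurable_trimap.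
- exact: trimapK.
- exact: triinvK.
- exact: measurable_trimapS.
- by rewrite mulr_gt0 ?invr_gt0.
- exact: trimap_scales.
- by move=> _ A mA; rewrite mul1e.
Qed.

Section change_of_variables.
Variables (c al be a : R).
Hypotheses (c0 : 0 < c) (be0 : 0 < be) (a0 : 0 < a).

Let cbe0 : 0 < c^-1 * be^-1. Proof. by rewrite mulr_gt0 ?invr_gt0. Qed.

Lemma integral_trimap D (f : R * R -> \bar R) :
  (\int[@leb2 R]_(x in trimap c al be @^-1` D) (a%:E * f (trimap c al be x)) =
   (a * (c^-1 * be^-1))%:E * \int[@leb2 R]_(x in D) f x)%E.
Proof.
exact: (integral_scaling (measurable_trimap c al be) (measurable_trimap _ _ _)
  (trimapK al c0 be0) (triinvK al c0 be0) cbe0 (trimap_scales al c0 be0)).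
Qed.

Lemma Rintegral_trimap D (f : R * R -> R) :
  \int[@leb2 R]_(x in trimap c al be @^-1` D) (a * f (trimap c al be x)) =
  a * (c^-1 * be^-1) * \int[@leb2 R]_(x in D) f x.
Proof.
exact: (Rintegral_scaling (measurable_trimap c al be) (measurable_trimap _ _ _)
  (trimapK al c0 be0) (triinvK al c0 be0) cbe0 (trimap_scales al c0 be0)).
Qed.

Lemma integral_trimapS D (f : R * R * R -> \bar R) :
  (\int[@leb3 R]_(p in trimapS c al be @^-1` D) (a%:E * f (trimapS c al be p)) =
   (a * (c^-1 * be^-1))%:E * \int[@leb3 R]_(p in D) f p)%E.
Proof.
exact: (integral_scaling (measurable_trimapS c al be) (measurable_trimapS _ _ _)
  (trimapSK al c0 be0) (triinvSK al c0 be0) cbe0 (trimapS_scales al c0 be0)).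
Qed.
End change_of_variables.
End maps.

(** * Borel measurability on products *)

Section open_measurability.

(** [X] has a countable base of neighbourhoods, not necessarily open, that
    belong to [M]. *)
Definition countable_base (X : topologicalType) (M : set (set X)) :=
  exists B : nat -> set X, (forall n, M (B n)) /\
    forall x U, nbhs x U -> exists n, B n x /\ B n `<=` U.

Lemma countable_base_open (X : topologicalType) (M : set (set X)) :
  countable_base M -> M set0 ->
  (forall F : (set X)^nat, (forall n, M (F n)) -> M (\bigcup_n F n)) ->
  forall U, open U -> M U.
Proof.
move=> [B [MB HB]] M0 MU U oU.
rewrite (_ : U = \bigcup_n (if `[< B n `<=` U >] then B n else set0)).
  by apply: MU => n; case: asboolP.
apply/seteqP; split => [x Ux|x [n _]]; last by case: asboolP => // + Bx; exact.
have [n [Bnx BnU]] := HB x U (open_nbhs_nbhs (conj oU Ux)).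
by exists n => //; case: asboolP.
Qed.

Lemma countable_base_prod (X Y : topologicalType) (M : set (set X)) (N : set (set Y))
    (P : set (set (X * Y))) :
  (forall A B, M A -> N B -> P (A `*` B)) ->
  countable_base M -> countable_base N -> countable_base P.
Proof.
move=> MNP [B [MB HB]] [C [NC HC]].
exists (fun n => if unpickle n is Some (i, j) then B i `*` C j else B 0%N `*` C 0%N); split.
  by move=> n; case: unpickle => [[i j]|]; exact: MNP.
move=> [x y] U [[V W] /= [Vx Wy] VWU].
have [i [Bix BiV]] := HB x V Vx; have [j [Cjy CjW]] := HC y W Wy.
exists (pickle (i, j)); rewrite pickleK; split => //.
by move=> [a b] [/= /BiV Va /CjW Wb]; exact: VWU.
Qed.

Lemma countable_base_real (R : realType) :
  countable_base (X := R) (fun A => measurable (A : set (measurableTypeR R))).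
Proof.
exists (fun n => if unpickle n is Some (p, q)
  then `](ratr p : R), (ratr q : R)[%classic else set0); split.
  by move=> n; case: unpickle => [[p q]|] //; exact: measurable_itv.
move=> x U /nbhs_ballP[e /= e0 eU].
have xe1 : x - e < x by rewrite ltrBlDr ltrDl.
have xe2 : x < x + e by rewrite ltrDl.
have [p] := rat_in_itvoo xe1; rewrite in_itv/= => /andP[p1 p2].
have [q] := rat_in_itvoo xe2; rewrite in_itv/= => /andP[q1 q2].
exists (pickle (p, q)); rewrite pickleK; split => /=.
  by rewrite in_itv/= p2 q1.
move=> y /=; rewrite in_itv/= => /andP[py yq]; apply: eU; rewrite /ball/= ltr_norml.
by apply/andP; split; lra.
Qed.

Context (R : realType).

Let M1 (A : set R) := measurable (A : set (measurableTypeR R)).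
Let M2 (A : set (R * R)) := measurable (A : set (mR2 R)).
Let M3 (A : set (R * R * R)) :=
  measurable (A : set (mR3 R)).

Let base2 : countable_base M2.
Proof.
by apply: (@countable_base_prod _ _ M1 M1) => [A B||];
  [exact: measurableX|exact: countable_base_real|exact: countable_base_real].
Qed.

Lemma open_measurable2 (U : set (R * R)) : open U ->
  measurable (U : set (mR2 R)).
Proof.
apply: (countable_base_open base2); first exact: measurable0.
by move=> F mF; exact: bigcupT_measurable.
Qed.

Lemma open_measurable3 (U : set (R * R * R)) : open U ->
  measurable (U : set (mR3 R)).
Proof.
have base3 : countable_base M3.
  by apply: (@countable_base_prod _ _ M2 M1) => [A B||];
    [exact: measurableX|exact: base2|exact: countable_base_real].
apply: (countable_base_open base3); first exact: measurable0.
by move=> F mF; exact: bigcupT_measurable.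
Qed.

Lemma continuous_measurable2 (f : R * R -> R) : continuous f ->
  measurable_fun setT (f : mR2 R -> measurableTypeR R).
Proof.
move=> /continuousP cf; apply: (measurability _ (RGenOpens.measurableE R)).
move=> _ [_ [a [b ->] <-]]; rewrite setTI; apply: open_measurable2.
exact/cf/interval_open.
Qed.

Lemma continuous_measurable3 (f : R * R * R -> R) : continuous f ->
  measurable_fun setT (f : mR3 R -> measurableTypeR R).
Proof.
move=> /continuousP cf; apply: (measurability _ (RGenOpens.measurableE R)).
move=> _ [_ [a [b ->] <-]]; rewrite setTI; apply: open_measurable3.
exact/cf/interval_open.
Qed.
End open_measurability.

(** * Directional derivatives *)

Section directional.
Context (R : realType).

Lemma derive_comp_linear (V W : normedModType R) (L : V -> W) (f : W -> R) (v x : V) :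
  (forall (h : R) u y, L (h *: u + y) = h *: L u + L y) ->
  'D_v (f \o L) x = 'D_(L v) f (L x).
Proof.
move=> linL; rewrite /derive.
suff -> : (fun h : R => h^-1 *: (((f \o L) \o shift x) (h *: v) - (f \o L) x)) =
          (fun h : R => h^-1 *: ((f \o shift (L x)) (h *: L v) - f (L x))) by [].
by apply/funext => h /=; rewrite linL.
Qed.

Lemma derivable_comp_linear (V W : normedModType R) (L : V -> W) (f : W -> R) (v x : V) :
  (forall (h : R) u y, L (h *: u + y) = h *: L u + L y) ->
  derivable f (L x) (L v) -> derivable (f \o L) x v.
Proof.
move=> linL; rewrite /derivable.
suff -> : (fun h : R => h^-1 *: (((f \o L) \o shift x) (h *: v) - (f \o L) x)) =
          (fun h : R => h^-1 *: ((f \o shift (L x)) (h *: L v) - f (L x))) by [].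
by apply/funext => h /=; rewrite linL.
Qed.

Lemma class_C_comp_linear (V W : normedModType R) (L : V -> W) n (f : W -> R) :
  (forall (h : R) u y, L (h *: u + y) = h *: L u + L y) -> continuous L ->
  class_C n f -> class_C n (f \o L).
Proof.
move=> linL cL; elim: n f => [|n IH] f /= [cf Hf].
  by split => //; move=> x; apply: continuous_comp; [exact: cL|exact: cf].
split; first by move=> x; apply: continuous_comp; [exact: cL|exact: cf].
case: Hf => df Hf; split=> [x v|v]; first exact: derivable_comp_linear.
rewrite (_ : 'D_v (f \o L) = 'D_(L v) f \o L); first exact: IH.
by apply/funext => x; exact: derive_comp_linear.
Qed.

Lemma class_CB (V : normedModType R) n (f g : V -> R) :
  class_C n f -> class_C n g -> class_C n (f - g).
Proof.
elim: n f g => [|n IH] f g /= [cf Hf] [cg Hg].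
  by split=> // x; apply: continuousB; [exact: cf|exact: cg].
split; first by move=> x; apply: continuousB; [exact: cf|exact: cg].
case: Hf => df Hf; case: Hg => dg Hg; split=> [x v|v]; first exact: derivableB.
rewrite (_ : 'D_v (f - g) = 'D_v f - 'D_v g); first exact: IH.
by apply/funext => x; rewrite deriveB.
Qed.

Lemma derivable_line (V : normedModType R) (f : V -> R) (v x : V) (t : R) :
  derivable f (t *: v + x) v -> is_derive t 1 (fun s : R => f (s *: v + x))
    ('D_v f (t *: v + x)).
Proof.
have E : (fun h : R => h^-1 *: (((fun s : R => f (s *: v + x)) \o shift t) (h *: 1) - f
  (t *: v + x))) =
  (fun h : R => h^-1 *: ((f \o shift (t *: v + x)) (h *: v) - f (t *: v + x))).
  by apply/funext => h /=; rewrite [h *: 1]mulr1 scalerDl addrA.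
by move=> df; split; rewrite /derivable /derive E.
Qed.

Lemma derivableZ_dir (V : normedModType R) (f : V -> R) (v x : V) (c : R) :
  derivable f x v -> is_derive x (c *: v) f (c * 'D_v f x).
Proof.
have [->|c0] := eqVneq c 0.
  by rewrite scale0r mul0r => _; exact: is_derive0.
move=> df.
have [df1 E1] : is_derive (0 : R) (1 : R) (fun s : R => f (s *: v + x)) ('D_v f x).
  by have := @derivable_line V f v x 0; rewrite scale0r add0r; apply.
have D0 : is_derive (c * 0 : R) (1 : R) (fun s : R => f (s *: v + x)) ('D_v f x)
  by rewrite mulr0; split.
have D1 : is_derive (0 : R) (1 : R) (fun s : R => c * s) c.
  by have := @is_deriveZ _ _ _ (@id R) c 0 1 1 (is_derive_id _ _); rewrite [c *: 1]mulr1.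
have [d2 E2] := is_derive1_comp D0 D1.
have H : (fun h : R => h^-1 *: ((((fun s : R => f (s *: v + x)) \o (fun s : R => c * s)) \o
  shift (0:R)) (h *: 1) -
      ((fun s : R => f (s *: v + x)) \o (fun s : R => c * s)) 0)) =
  (fun h : R => h^-1 *: ((f \o shift x) (h *: (c *: v)) - f x)).
  apply/funext => h /=; by rewrite addr0 [h *: 1]mulr1 mulr0 scale0r add0r scalerA [c * h]mulrC.
move: d2 E2; rewrite /derivable /derive H => d2 E2; split => //; rewrite mulrC; exact: E2.
Qed.

(** Mean value theorem along the segment from [x] to [x + h v]. *)
Lemma MVT_dir (V : normedModType R) (f : V -> R) (v x : V) (h : R) :
  continuous f -> (forall y, derivable f y v) ->
  exists2 s : R, 0 <= s <= 1 & f (h *: v + x) - f x = h * 'D_v f (s *: (h *: v) + x).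
Proof.
move=> cf df.
have dg (t : R) : is_derive t 1 (fun s : R => f (s *: (h *: v) + x))
  (h * 'D_v f (t *: (h *: v) + x)).
  have [d1 <-] := derivableZ_dir h (df (t *: (h *: v) + x)).
  exact: derivable_line.
have cg : {within `[0, 1], continuous (fun s : R => f (s *: (h *: v) + x))}.
  by apply: derivable_within_continuous => t _; case: (dg t).
have [s s01] := @MVT_segment R _ (fun t => h * 'D_v f (t *: (h *: v) + x)) 0 1
  ler01 (fun t _ => dg t) cg.
rewrite scale1r scale0r add0r subr0 mulr1 => E.
by exists s => //; move: s01; rewrite in_itv.
Qed.

(** For a function with continuous directional derivatives, the difference
    quotient in direction [v + w] splits into one in direction [w] at [x] and one
    in direction [v] at [x + h w]; the latter is a value of ['D_v f] near [x]. *)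
Lemma deriveD_dir (V : normedModType R) (f : V -> R) (v w x : V) :
  class_C 1 f -> 'D_(v + w) f x = 'D_v f x + 'D_w f x.
Proof.
move=> [cf [df cdf]]; apply: cvg_lim => //.
have cdv : {for x, continuous ('D_v f)} by case: (cdf v) => c _; exact: c.
pose g (h : R) := h^-1 *: (f (h *: v + (h *: w + x)) - f (h *: w + x)).
have -> : (fun h : R => h^-1 *: ((f \o shift x) (h *: (v + w)) - f x)) =
   g + (fun h : R => h^-1 *: ((f \o shift x) (h *: w) - f x)).
  apply/funext => h.
  rewrite -[RHS]/(h^-1 * (f (h *: v + (h *: w + x)) - f (h *: w + x)) + h^-1 *
    (f (h *: w + x) - f x)).
  rewrite -mulrDr subrKA /=; congr (_ * (f _ - _)); by rewrite scalerDr addrA.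
apply: cvgD; last exact: df.
apply/cvgrPdist_le => e e0.
have /cvgrPdist_le/(_ e e0)/nbhs_ballP[d /= d0 dP] := cdv.
have k0 : 0 < `|v| + `|w| + 1 by rewrite ltr_wpDl ?addr_ge0.
near=> h.
have h0 : h != 0 by near: h; exact: nbhs_dnbhs_neq.
have [s /andP[s0 s1] E] := @MVT_dir V f v (h *: w + x) h cf (fun y => df y v).
rewrite /g E [_ *: _]mulKf//; apply: dP; rewrite -ball_normE /ball_/=.
rewrite addrA opprD addrCA subrr addr0 normrN.
apply: (@le_lt_trans _ _ (`|h| * (`|v| + `|w| + 1))).
  rewrite (le_trans (ler_normD _ _))// !normrZ (ger0_norm s0) -addrA !mulrDr lerD//.
    by rewrite ler_piMl// mulr_ge0.
  by rewrite lerDl mulr1.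
rewrite -ltr_pdivlMr//; near: h.
apply: dnbhs0_lt; exact: divr_gt0.
Unshelve. all: by end_near. Qed.

Lemma derive_lin (V : normedModType R) (f : V -> R) (v w x : V) (a b : R) :
  class_C 1 f -> 'D_(a *: v + b *: w) f x = a * 'D_v f x + b * 'D_w f x.
Proof.
move=> Cf; rewrite deriveD_dir//; case: Cf => _ [df _].
by have [_ ->] := derivableZ_dir a (df x v); have [_ ->] := derivableZ_dir b (df x w).
Qed.

End directional.

(** * A twisted Poincare inequality on the circle *)

Section poincare.
Context (R : realType).
Notation mu := (@lebesgue_measure R).
Implicit Types (f g df : R -> R).

Lemma is_derive_continuous f df : (forall t : R, is_derive t 1 f (df t)) -> continuous f.
Proof. by move=> Df t; apply: differentiable_continuous; apply/derivable1_diffP;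
  case: (Df t). Qed.

Lemma FTC2 f df (x y : R) : x < y -> (forall t : R, is_derive t 1 f (df t)) -> continuous df ->
  (\int[mu]_(t in `[x, y]) (df t)%:E = (f y - f x)%:E)%E.
Proof.
move=> xy Df cdf; rewrite EFinB; apply: continuous_FTC2 => //.
- exact: continuous_subspaceT.
- have cf := is_derive_continuous Df.
  split; first by move=> t _; case: (Df t).
  + by apply: cvg_at_right_filter; exact: cf.
  + by apply: cvg_at_left_filter; exact: cf.
- by move=> t _; rewrite derive1E; case: (Df t).
Qed.

Lemma continuous_integrable_segment f (x y : R) : continuous f ->
  mu.-integrable `[x, y] (EFin \o f).
Proof.
move=> cf; apply: continuous_compact_integrable; first exact: segment_compact.
exact: continuous_subspaceT.
Qed.

(** Cauchy-Schwarz for the increment of [f].  With [m] the mean slope, integrate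
    [2 m f' - m^2 <= f'^2]; the left-hand side has an explicit primitive. *)
Lemma sqr_increment_le f df (x y : R) : x <= y ->
  (forall t : R, is_derive t 1 f (df t)) -> continuous df ->
  (((f y - f x) ^+ 2)%:E <= (y - x)%:E * \int[mu]_(t in `[x, y]) ((df t) ^+ 2)%:E)%E.
Proof.
rewrite le_eqVlt => /predU1P[->|xy] Df cdf.
  by rewrite !subrr expr0n/= mul0e.
have xy0 : 0 < y - x by rewrite subr_gt0.
pose m := (f y - f x) / (y - x).
have Dg (t : R) : is_derive t 1 (fun t : R => 2 * m * f t - m ^+ 2 * t) (2 * m * df t - m ^+ 2).
  have := @is_deriveB _ _ _ ((2 * m) \*: f) ((m ^+ 2) \*: (@id R)) t 1 _ _
    (@is_deriveZ _ _ _ f (2 * m) t 1 _ (Df t)) (@is_deriveZ _ _ _ (@id R) (m ^+ 2) t 1 _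
      (is_derive_id _ _)).
  by rewrite [_ *: 1]mulr1.
have cg : continuous (fun t => 2 * m * df t - m ^+ 2).
  by move=> t; apply: cvgB; [apply: cvgM; [exact: cvg_cst|exact: cdf]|exact: cvg_cst].
have cs : continuous (fun t => df t ^+ 2).
  by move=> t; apply: (cvgM (cdf t) (cdf t)).
have H : (\int[mu]_(t in `[x, y]) (2 * m * df t - m ^+ 2)%:E <= \int[mu]_(t in `[x, y])
  ((df t) ^+ 2)%:E)%E.
  apply: le_integral => //; [exact: continuous_integrable_segment|exact:
    continuous_integrable_segment|].
  move=> t _; rewrite lee_fin -subr_ge0.
  by rewrite (_ : _ - _ = (df t - m) ^+ 2) ?sqr_ge0//; ring.
rewrite (FTC2 xy Dg cg) in H.
rewrite muleC -lee_pdivrMr//; apply: le_trans H.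
rewrite -EFinM lee_fin /m le_eqVlt; apply/orP; left; apply/eqP.
by field; rewrite gt_eqF.
Qed.

Lemma cos2pi_lt1 (w : R) : 0 < w <= 1 / 2 -> cos (2 * pi * w) < 1.
Proof.
move=> /andP[w0 w1]; have p0 := pi_gt0 R.
have x0 : 0 < 2 * pi * w by rewrite !mulr_gt0.
have x1 : 2 * pi * w <= pi.
  rewrite [leRHS](_ : _ = 2 * pi * (1 / 2)); last by field.
  by rewrite ler_pM2l// mulr_gt0.
by rewrite -[ltRHS]cos0 ltr_cos ?in_itv/= ?lexx ?x1 ?ltW.
Qed.

(** With [u = a + i b], the integrand on the right is [|i u' - w u|^2].  The pair
    [(G1, G2)] is the gauge transform [exp (i w t) u]; its increments along
    [[0, 2 pi]] are controlled by the right-hand side.  The increment over a full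
    period is [(exp (2 pi i w) - 1) u 0], of squared modulus [k |u 0|^2] with
    [k = 2 - 2 cos (2 pi w) > 0], which bounds [u 0] and then [u]. *)
Lemma poincare_twisted (w : R) : 0 < w <= 1 / 2 ->
  exists2 C : R, 0 < C & forall a b da db : R -> R,
    (forall t : R, is_derive t 1 a (da t)) -> (forall t : R, is_derive t 1 b (db t)) ->
    continuous da -> continuous db -> a (2 * pi) = a 0 -> b (2 * pi) = b 0 ->
    (\int[mu]_(t in `[0%R, (2 * pi)%R]) (a t ^+ 2 + b t ^+ 2)%:E <=
     C%:E * \int[mu]_(t in `[0%R, (2 * pi)%R])
       ((db t + w * a t) ^+ 2 + (da t - w * b t) ^+ 2)%:E)%E.
Proof.
move=> hw; have p0 := pi_gt0 R; have pp0 : 0 < 2 * pi :> R by rewrite mulr_gt0.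
pose k : R := 2 - 2 * cos (2 * pi * w).
have k0 : 0 < k by have := cos2pi_lt1 hw; rewrite /k; lra.
exists (2 * pi * (8 * pi / k + 8 * pi)).
  by rewrite mulr_gt0// addr_gt0// ?divr_gt0// mulr_gt0.
move=> a b da db Da Db cda cdb aper bper.
have ca := is_derive_continuous Da; have cb := is_derive_continuous Db.
pose cw t := cos (w * t); pose sw t := sin (w * t).
have Dw (t : R) : is_derive t 1 (fun t : R => w * t) w.
  by have := @is_deriveZ _ _ _ (@id R) w t 1 1 (is_derive_id _ _); rewrite [w *: 1]mulr1.
have Dcw (t : R) : is_derive t 1 cw (- w * sw t).
  have := @is_derive1_comp _ cos (fun t => w * t) t _ _ (is_derive_cos _) (Dw t).
  by move/is_derive_eq; apply; rewrite /sw; ring.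
have Dsw (t : R) : is_derive t 1 sw (w * cw t).
  have := @is_derive1_comp _ sin (fun t => w * t) t _ _ (is_derive_sin _) (Dw t).
  by move/is_derive_eq; apply; rewrite /cw mulrC.
have ccw := is_derive_continuous Dcw; have csw := is_derive_continuous Dsw.
pose h1 t := da t - w * b t; pose h2 t := db t + w * a t.
pose G1 t := a t * cw t - b t * sw t; pose G2 t := a t * sw t + b t * cw t.
pose dG1 t := h1 t * cw t - h2 t * sw t; pose dG2 t := h1 t * sw t + h2 t * cw t.
have DG1 (t : R) : is_derive t 1 G1 (dG1 t).
  have := @is_deriveB _ _ _ _ _ _ _ _ _ (@is_deriveM _ _ a cw t 1 _ _ (Da t) (Dcw t))
    (@is_deriveM _ _ b sw t 1 _ _ (Db t) (Dsw t)).
  by move/is_derive_eq; apply; rewrite /dG1 /h1 /h2 /GRing.scale/=; ring.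
have DG2 (t : R) : is_derive t 1 G2 (dG2 t).
  have := @is_deriveD _ _ _ _ _ _ _ _ _ (@is_deriveM _ _ a sw t 1 _ _ (Da t) (Dsw t))
    (@is_deriveM _ _ b cw t 1 _ _ (Db t) (Dcw t)).
  by move/is_derive_eq; apply; rewrite /dG2 /h1 /h2 /GRing.scale/=; ring.
have cwM f : continuous f -> continuous (fun t => w * f t).
  by move=> cf t; apply: cvgM; [exact: cvg_cst|exact: cf].
have ch1 : continuous h1 by move=> t; apply: cvgB; [exact: cda|exact: cwM].
have ch2 : continuous h2 by move=> t; apply: cvgD; [exact: cdb|exact: cwM].
have cdG1 : continuous dG1.
  by move=> t; apply: cvgB; apply: cvgM; [exact: ch1|exact: ccw|exact: ch2|exact: csw].
have cdG2 : continuous dG2.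
  by move=> t; apply: cvgD; apply: cvgM; [exact: ch1|exact: csw|exact: ch2|exact: ccw].
have csq f : continuous f -> continuous (fun t => f t ^+ 2).
  by move=> cf t; apply: (cvgM (cf t) (cf t)).
have ch : continuous (fun t => h2 t ^+ 2 + h1 t ^+ 2).
  by move=> t; apply: cvgD; [exact: csq|exact: csq].
have cs1 t : cw t ^+ 2 + sw t ^+ 2 = 1 by exact: cos2Dsin2.
set I := (\int[mu]_(t in _) (_ ^+ 2 + (da t - _) ^+ 2)%:E)%E.
have Ifin : I \is a fin_num.
  by apply: integrable_fin_num => //; exact: (continuous_integrable_segment _ _ ch).
have I0 : (0 <= I)%E.
  by apply: integral_ge0 => t _; rewrite lee_fin addr_ge0 ?sqr_ge0.
have i0 : 0 <= fine I by rewrite fine_ge0.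
have mc f (D : set R) : measurable D -> continuous f -> measurable_fun D (EFin \o f).
  move=> mD cf; apply/measurable_EFinP; apply: measurable_funTS;
    exact: continuous_measurable_fun.
have incr (G dG : R -> R) : (forall t : R, is_derive t 1 G (dG t)) -> continuous dG ->
    (forall t, dG t ^+ 2 <= h2 t ^+ 2 + h1 t ^+ 2) ->
    forall t, 0 <= t <= 2 * pi -> (G t - G 0) ^+ 2 <= 2 * pi * fine I.
  move=> DG cdG le t /andP[t0 t1]; rewrite -lee_fin [leRHS]EFinM fineK//.
  apply: le_trans (sqr_increment_le t0 DG cdG) _; rewrite subr0.
  apply: lee_pmul => //.
    by apply: integral_ge0 => s _; rewrite lee_fin sqr_ge0.
  have sub : `[0, t] `<=` `[0, 2 * pi].
    by apply: subset_itvl; rewrite bnd_simp.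
  apply: (@le_trans _ _ (\int[mu]_(s in `[0%R, t]) (h2 s ^+ 2 + h1 s ^+ 2)%:E)%E).
    apply: ge0_le_integral => //.
    - by move=> s _; rewrite lee_fin sqr_ge0.
    - by apply: mc => //; exact: csq.
    - exact: mc.
    - by move=> s _; rewrite lee_fin.
  apply: ge0_subset_integral => //; first exact: mc.
  by move=> s _; rewrite lee_fin addr_ge0 ?sqr_ge0.
have nrm t : dG1 t ^+ 2 + dG2 t ^+ 2 = h2 t ^+ 2 + h1 t ^+ 2.
  rewrite -[RHS]mulr1 -(cs1 t) /dG1 /dG2; ring.
have inc1 : forall t, 0 <= t <= 2 * pi -> (G1 t - G1 0) ^+ 2 <= 2 * pi * fine I.
  by apply: incr DG1 cdG1 _ => t; rewrite -nrm lerDl sqr_ge0.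
have inc2 : forall t, 0 <= t <= 2 * pi -> (G2 t - G2 0) ^+ 2 <= 2 * pi * fine I.
  by apply: incr DG2 cdG2 _ => t; rewrite -nrm lerDr sqr_ge0.
have G0 : k * (a 0 ^+ 2 + b 0 ^+ 2) <= 4 * pi * fine I.
  have := inc1 (2 * pi); have := inc2 (2 * pi); rewrite lexx ltW//= => /(_ isT) e2 /(_ isT) e1.
  rewrite (_ : k * _ = (G1 (2 * pi) - G1 0) ^+ 2 + (G2 (2 * pi) - G2 0) ^+ 2).
    by rewrite (le_trans (lerD e1 e2))// le_eqVlt; apply/orP; left; apply/eqP; ring.
  have := cs1 (2 * pi); rewrite /G1 /G2 aper bper /k.
  have -> : cw 0 = 1 by rewrite /cw mulr0 cos0.
  have -> : sw 0 = 0 by rewrite /sw mulr0 sin0.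
  rewrite [2 * pi * w]mulrC -/(cw _).
  set c := cw _; set s := sw _ => cs.
  have -> : 2 - 2 * c = c ^+ 2 + s ^+ 2 + 1 - 2 * c by rewrite cs; ring.
  ring.
have bound t : 0 <= t <= 2 * pi -> a t ^+ 2 + b t ^+ 2 <= (8 * pi / k + 8 * pi) * fine I.
  move=> tI; have e1 := inc1 t tI; have e2 := inc2 t tI.
  have -> : a t ^+ 2 + b t ^+ 2 = G1 t ^+ 2 + G2 t ^+ 2.
    rewrite -[LHS]mulr1 -(cs1 t) /G1 /G2; ring.
  have E0 : G1 0 ^+ 2 + G2 0 ^+ 2 = a 0 ^+ 2 + b 0 ^+ 2.
    rewrite -[RHS]mulr1 -(cs1 0) /G1 /G2; ring.
  have q : a 0 ^+ 2 + b 0 ^+ 2 <= 4 * pi / k * fine I.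
    by rewrite mulrAC ler_pdivlMr// mulrC.
  have q1 : G1 t ^+ 2 <= 2 * (G1 t - G1 0) ^+ 2 + 2 * G1 0 ^+ 2.
    by rewrite -subr_ge0 (_ : _ - _ = (G1 t - 2 * G1 0) ^+ 2) ?sqr_ge0//; ring.
  have q2 : G2 t ^+ 2 <= 2 * (G2 t - G2 0) ^+ 2 + 2 * G2 0 ^+ 2.
    by rewrite -subr_ge0 (_ : _ - _ = (G2 t - 2 * G2 0) ^+ 2) ?sqr_ge0//; ring.
  have -> : (8 * pi / k + 8 * pi) * fine I = 2 * (4 * pi / k * fine I) + 4 * (2 * pi * fine I).
    by field; rewrite gt_eqF.
  lra.
apply: (@le_trans _ _ (\int[mu]_(t in `[0%R, (2 * pi)%R])
    ((8 * pi / k + 8 * pi) * fine I)%:E)%E).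
  apply: ge0_le_integral => //.
  - by move=> s _; rewrite lee_fin addr_ge0 ?sqr_ge0.
  - apply: (mc (fun t => a t ^+ 2 + b t ^+ 2)) => // t.
    by apply: cvgD; [exact: csq|exact: csq].
rewrite [leLHS](_ : _ = ((8 * pi / k + 8 * pi) * fine I)%:E * mu `[0%R, (2 * pi)%R])%E;
  last first.
  by apply: integral_cst; exact: measurable_itv.
rewrite lebesgue_measure_itv/= lte_fin pp0 -EFinB subr0 -EFinM.
by rewrite -[X in (_ <= _ * X)%E]fineK// -EFinM lee_fin le_eqVlt; apply/orP; left;
  apply/eqP; ring.
Qed.
End poincare.

(** * Integration over layers *)

Section lay.
Context (R : realType).
Notation leb := (@lebesgue_measure R).

Lemma cnorm2E (z : R[i]) : cnorm2 z = complex.Re z ^+ 2 + complex.Im z ^+ 2.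
Proof. by case: z => a b; rewrite /cnorm2 /= sqr_sqrtr// addr_ge0 ?sqr_ge0. Qed.

Lemma cnorm2_ge0 (z : R[i]) : 0 <= cnorm2 z.
Proof. by rewrite /cnorm2 sqr_ge0. Qed.

Lemma measurable_invr_pos (D : set (measurableTypeR R)) :
  (forall x, D x -> 0 < x) ->
  measurable_fun D (fun x : measurableTypeR R => x^-1 : measurableTypeR R).
Proof.
move=> D0; apply: (@measurable_funS _ _ _ _ (`]0, +oo[%classic : set (measurableTypeR R))).
- exact: measurable_itv.
- by move=> x Dx /=; rewrite in_itv/= D0.
apply: open_continuous_measurable_fun; first exact: interval_open.
by move=> x; rewrite inE/= in_itv/= andbT => x0; apply: inv_continuous; rewrite gt_eqF.
Qed.

Lemma Gui_measurable (t : R) : measurable (Gui t : set (mR2 R)).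
Proof.
have m1 : measurable_fun setT (fst : mR2 R -> measurableTypeR R) by exact: measurable_fst.
have m2 : measurable_fun setT (snd : mR2 R -> measurableTypeR R) by exact: measurable_snd.
have m3 : measurable_fun setT (fun x : mR2 R => x.2 * tan t) by apply: measurable_funM.
have pos (f : mR2 R -> R) : measurable_fun setT f -> measurable [set x | 0 < f x].
  move=> mf; rewrite (_ : [set x | _] = setT `&` f @^-1` `]0, +oo[%classic).
    by apply: mf => //; exact: measurable_itv.
  by apply/seteqP; split=> x /=; rewrite in_itv/= andbT// => -[].
rewrite (_ : Gui t = [set x | 0 < x.1] `&` [set x | 0 < x.2 + pi / sin t] `&`
   [set x | 0 < x.1 - x.2 * tan t] `&` [set x | 0 < x.2 * tan t + pi / cos t - x.1]).
  repeat apply: measurableI.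
  - exact: pos.
  - by apply: pos; apply: measurable_funD.
  - by apply: pos; apply: measurable_funB.
  - by apply: pos; apply: measurable_funB => //; apply: measurable_funD.
apply/seteqP; split => -[x y] /=; rewrite /Gui/=.
- move=> [x0 a b c]; move: b; rewrite gt_max => /andP[_ b].
  by split; first split; first split; lra.
- by move=> [[[x0 a] b] c]; split; rewrite ?gt_max ?x0/=; lra.
Qed.

Lemma Lay_measurable (t : R) : measurable (Lay t : set (mR3 R)).
Proof.
rewrite (_ : Lay t = Gui t `*` `[0, 2 * pi[%classic); last first.
  by apply/seteqP; split => -[x p] /=; rewrite /Lay/= in_itv.
by apply: measurableX; [exact: Gui_measurable|exact: measurable_itv].
Qed.

(** Sigma-finiteness of the plane measure makes Tonelli's theorem available for
    [leb3], which is the product of [leb2] and [leb]. *)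
Lemma leb2_sigma_finite : sigma_finite setT (@leb2 R).
Proof.
have /sigma_finiteP[F [FT Fnd Fm]] := @sigma_finiteT _ _ _ leb.
exists (fun n => F n `*` F n).
  rewrite -setXTT FT; apply/seteqP; split =>
    [[x y] /= [[n _ Fnx] [m _ Fmy]]|[x y] [n _ [/= ? ?]]].
    exists (maxn n m) => //; split => /=.
      by move: x Fnx; apply/subsetPset/Fnd/leq_maxl.
    by move: y Fmy; apply/subsetPset/Fnd/leq_maxr.
  by split; exists n.
move=> n; have [mF Ff] := Fm n; split; first exact: measurableX.
by rewrite /leb2 product_measure1E// lte_mul_pinfty// ge0_fin_numE.
Qed.

HB.instance Definition _ := Measure.on (@leb2 R).
HB.instance Definition _ := Measure_isSigmaFinite.Build _ _ _ (@leb2 R) leb2_sigma_finite.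

(** The fundamental domain of the circle is half-open; the endpoint [2 pi] is
    harmless and makes the fiber integrals live on a segment. *)
Lemma fubini_Lay (t : R) (F : mR3 R -> R) : measurable_fun (Lay t) F ->
  (forall p, Lay t p -> 0 <= F p) ->
  let G x := (\int[leb]_(s in `[0%R, (2 * pi)%R]) (F (x, s))%:E)%E in
  measurable_fun (Gui t) G /\
  (\int[@leb3 R]_(p in Lay t) (F p)%:E = \int[@leb2 R]_(x in Gui t) G x)%E.
Proof.
move=> mF F0 G.
pose f : mR3 R -> \bar R := (EFin \o F) \_ (Lay t).
have mf : measurable_fun setT f.
  apply/(measurable_restrictT _ _).1; first exact: Lay_measurable.
  exact/measurable_EFinP.
have f0 p : (0 <= f p)%E.
  by rewrite /f patchE; case: ifP => //; rewrite inE => /F0; rewrite lee_fin.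
have E : fubini_F leb f = G \_ (Gui t).
  apply/funext => x; rewrite /fubini_F patchE; case: ifPn => [|/negP]; rewrite inE => Gx;
    last first.
    rewrite integral0_eq// => s _; rewrite /f patchE; case: ifP => //; rewrite inE => -[/= ? _].
    by [].
  rewrite /G -integral_itv_bndo_bndc; last first.
    apply: (@eq_measurable_fun _ _ _ _ _ (fun s => f (x, s))).
      move=> s; rewrite inE/= in_itv/= => sI; rewrite /f patchE mem_set//.
    by apply: measurable_funTS; apply: measurableT_comp => //; exact: measurable_fun_pair.
  rewrite [in RHS]integral_mkcond; apply: eq_integral => s _.
  rewrite /f !patchE; have -> // : ((x, s) \in Lay t) = (s \in `[0%R, (2 * pi)%R[%classic).
  by apply/idP/idP; rewrite !inE/= in_itv/= /Lay/= => // -[].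
split.
  apply/(measurable_restrictT _ _).2; first exact: Gui_measurable.
  by rewrite -E; exact: measurable_fun_fubini_tonelli_F.
rewrite integral_mkcond -/f (@fubini_tonelli1 _ _ _ _ _ (@leb2 R) leb f)//.
by rewrite E -integral_mkcond.
Qed.

Lemma Lay_le_fiber (t C : R) (F F' : mR3 R -> R) : 0 <= C ->
  measurable_fun (Lay t) F -> measurable_fun (Lay t) F' ->
  (forall x s, Gui t x -> 0 <= F (x, s)) -> (forall x s, Gui t x -> 0 <= F' (x, s)) ->
  (forall x, Gui t x -> (\int[leb]_(s in `[0%R, (2 * pi)%R]) (F' (x, s))%:E <=
     C%:E * \int[leb]_(s in `[0%R, (2 * pi)%R]) (F (x, s))%:E)%E) ->
  (\int[@leb3 R]_(p in Lay t) (F' p)%:E <= C%:E * \int[@leb3 R]_(p in Lay t) (F p)%:E)%E.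
Proof.
move=> C0 mF mF' p0 p0' le.
have F0 p : Lay t p -> 0 <= F p by case: p => x s [/= Gx _]; exact: p0.
have F'0 p : Lay t p -> 0 <= F' p by case: p => x s [/= Gx _]; exact: p0'.
have [mG ->] := fubini_Lay mF F0; have [mG' ->] := fubini_Lay mF' F'0.
have G0 x : Gui t x -> (0 <= \int[leb]_(s in `[0%R, (2 * pi)%R]) (F (x, s))%:E)%E.
  by move=> Gx; apply: integral_ge0 => s _; rewrite lee_fin p0.
have G0' x : Gui t x -> (0 <= \int[leb]_(s in `[0%R, (2 * pi)%R]) (F' (x, s))%:E)%E.
  by move=> Gx; apply: integral_ge0 => s _; rewrite lee_fin p0'.
rewrite -ge0_integralZl_EFin//; last exact: Gui_measurable.
apply: ge0_le_integral => //; first exact: Gui_measurable.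
exact: measurable_funeM.
Qed.

(** The derivative along the fiber over [x] is the derivative in direction
    [(0, 0, 1)]. *)
Lemma derive_fiber (f : R * R * R -> R) (x : R * R) (s : R) : class_C 1 f ->
  is_derive s 1 (fun s : R => f (x, s)) ('D_(0, 0, 1) f (x, s)).
Proof.
move=> [_ [df _]].
have E (s' : R) : s' *: ((0, 0, 1) : R * R * R) + (x, 0) = (x, s').
  case: x => x1 x2; rewrite -[LHS]/((s' * 0 + x1, s' * 0 + x2), s' * 1 + 0).
  by rewrite !mulr0 mulr1 !add0r addr0.
have := @derivable_line R _ f (0, 0, 1) (x, 0) s; rewrite E => /(_ (df _ _)).
by rewrite (_ : (fun s' : R => _) = (fun s' => f (x, s'))) //; apply/funext => s'; rewrite E.
Qed.

Lemma continuous_fiber (f : R * R * R -> R) (x : R * R) : continuous f ->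
  continuous (fun s : R => f (x, s)).
Proof.
move=> cf s; apply: (@continuous_comp _ _ _ (fun s : R => (x, s)) f); last exact: cf.
by apply: (@cvg_pair _ _ _ (nbhs s) (nbhs x) (nbhs s)); [exact: cvg_cst|exact: cvg_id].
Qed.

Lemma Gui_r_gt0 (t : R) x : Gui t x -> 0 < x.1.
Proof. by case. Qed.

(** The integrand of [q0] at radius [r], as a function of the values [d1], [d2],
    [d3] of the three partial derivatives and of the value [u]. *)
Definition density (r om : R) (d1 d2 d3 u : R[i]) : R :=
  (cnorm2 d1 + cnorm2 d2 + cnorm2 ((0 +i* 1)%C * d3 - om%:C%C * u) / r ^+ 2) * r.

Section density_bound.
Variables (c al be om om' : R).
Hypothesis c0 : 0 < c.

(** Pulling back multiplies the density by at most a constant, except for the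
    term in [|u|^2 / r] that comes from the change of flux. *)
Lemma density_le (r : R) (d1 d2 d3 u : R[i]) : 0 < r ->
  density (r / c) om' (c%:C%C * d1 + al%:C%C * d2) (be%:C%C * d2) d3 u <=
  ((2 * c ^+ 2 + 2 * al ^+ 2 + be ^+ 2) / c + 2 * c) * density r om d1 d2 d3 u
   + 2 * c * (om - om') ^+ 2 / r * cnorm2 u.
Proof.
move=> r0; case: d1 => x1 y1; case: d2 => x2 y2; case: d3 => x3 y3; case: u => a b.
rewrite /density !cnorm2E /=.
rewrite -subr_ge0.
set h1 := - y3 - om * a; set h2 := x3 - om * b.
pose S := (c * x1 - al * x2) ^+ 2 + (c * y1 - al * y2) ^+ 2 + be ^+ 2 * (x1 ^+ 2 + y1 ^+ 2)
  + (2 * al ^+ 2) * (x1 ^+ 2 + y1 ^+ 2) + 2 * c ^+ 2 * (x2 ^+ 2 + y2 ^+ 2).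
pose T := (h1 - (om - om') * a) ^+ 2 + (h2 - (om - om') * b) ^+ 2.
(* Parallelogram law for the gradient terms (S) and for the angular term (T). *)
rewrite [X in 0 <= X](_ : _ = r / c * S + c / r * T
  + 2 * c * r * (x1 ^+ 2 + y1 ^+ 2 + (x2 ^+ 2 + y2 ^+ 2))
  + (2 * c ^+ 2 + 2 * al ^+ 2 + be ^+ 2) / (c * r) * (h1 ^+ 2 + h2 ^+ 2)); last first.
  by rewrite /S /T /h1 /h2; field; rewrite !gt_eqF.
have rc : 0 <= r / c by rewrite divr_ge0 ?ltW.
have cr : 0 <= c / r by rewrite divr_ge0 ?ltW.
have ci : 0 <= (c * r)^-1 by rewrite invr_ge0 mulr_ge0 ?ltW.
have c1 := ltW c0; have r1 := ltW r0; have two : 0 <= 2 :> R by [].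
by rewrite /S /T; repeat first [exact: sqr_ge0 | by [] | apply: addr_ge0 | apply: mulr_ge0].
Qed.

End density_bound.

Lemma densityE (r om : R) (d1 d2 d3 u : R[i]) : density r om d1 d2 d3 u =
  (complex.Re d1 ^+ 2 + complex.Im d1 ^+ 2 + (complex.Re d2 ^+ 2 + complex.Im d2 ^+ 2)
   + ((complex.Im d3 + om * complex.Re u) ^+ 2 + (complex.Re d3 - om * complex.Im u) ^+ 2)
     * r^-1 ^+ 2) * r.
Proof.
case: d1 => x1 y1; case: d2 => x2 y2; case: d3 => x3 y3; case: u => a b.
by rewrite /density !cnorm2E /= -exprVn; congr (_ * _); ring.
Qed.

Lemma density_ge0 (r om : R) (d1 d2 d3 u : R[i]) : 0 < r -> 0 <= density r om d1 d2 d3 u.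
Proof.
move=> r0; rewrite densityE.
have r1 := ltW r0; have ri : 0 <= r^-1 ^+ 2 by exact: sqr_ge0.
by repeat first [exact: sqr_ge0 | by [] | apply: addr_ge0 | apply: mulr_ge0].
Qed.

(** Continuity of a complex-valued function, by real and imaginary parts. *)
Definition ccont (V : topologicalType) (f : V -> R[i]) :=
  continuous (fun x => complex.Re (f x)) /\ continuous (fun x => complex.Im (f x)).

Lemma Re_realM (k : R) (z : R[i]) : complex.Re (k%:C%C * z) = k * complex.Re z.
Proof. by case: z => a b /=; rewrite mul0r subr0. Qed.

Lemma Im_realM (k : R) (z : R[i]) : complex.Im (k%:C%C * z) = k * complex.Im z.
Proof. by case: z => a b /=; rewrite mul0r addr0. Qed.

Lemma ReD (z1 z2 : R[i]) : complex.Re (z1 + z2) = complex.Re z1 + complex.Re z2.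
Proof. by case: z1; case: z2. Qed.
Lemma ImD (z1 z2 : R[i]) : complex.Im (z1 + z2) = complex.Im z1 + complex.Im z2.
Proof. by case: z1; case: z2. Qed.

Lemma ccont_lin (V : topologicalType) (f g : V -> R[i]) (a b : R) :
  ccont f -> ccont g -> ccont (fun x => a%:C%C * f x + b%:C%C * g x).
Proof.
move=> [f1 f2] [g1 g2]; split=> x.
- rewrite (_ : (fun x => _) = (fun x => a * complex.Re (f x) + b * complex.Re (g x)));
    last first.
    by apply/funext => y; rewrite ReD !Re_realM.
  by apply: cvgD; apply: cvgM; [exact: cvg_cst|exact: f1|exact: cvg_cst|exact: g1].
- rewrite (_ : (fun x => _) = (fun x => a * complex.Im (f x) + b * complex.Im (g x)));
    last first.
    by apply/funext => y; rewrite ImD !Im_realM.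
  by apply: cvgD; apply: cvgM; [exact: cvg_cst|exact: f2|exact: cvg_cst|exact: g2].
Qed.

Lemma cmeasurable_lin d (T : measurableType d) (D : set T) (f g : T -> R[i]) (a b : R) :
  cmeasurable D f -> cmeasurable D g -> cmeasurable D (fun x => a%:C%C * f x + b%:C%C * g x).
Proof.
move=> [f1 f2] [g1 g2]; split.
- under eq_fun do rewrite ReD !Re_realM.
  by apply: measurable_funD; apply: measurable_funM.
- under eq_fun do rewrite ImD !Im_realM.
  by apply: measurable_funD; apply: measurable_funM.
Qed.

Lemma density_continuous (V : topologicalType) (r om : R) (d1 d2 d3 u : V -> R[i]) :
  ccont d1 -> ccont d2 -> ccont d3 -> ccont u ->
  continuous (fun x => density r om (d1 x) (d2 x) (d3 x) (u x)).
Proof.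
move=> [p1 q1] [p2 q2] [p3 q3] [pu qu] x.
rewrite /continuous_at (funext (fun y => densityE r om (d1 y) (d2 y) (d3 y) (u y))) densityE.
have sq (f : V -> R) : f y @[y --> x] --> f x -> f y ^+ 2 @[y --> x] --> f x ^+ 2.
  by move=> cf; exact: (cvgM cf cf).
apply: cvgM; last exact: cvg_cst.
apply: cvgD; first by apply: cvgD; apply: cvgD; apply: sq;
  [exact: p1|exact: q1|exact: p2|exact: q2].
apply: cvgM; last exact: cvg_cst.
apply: cvgD; apply: sq.
- by apply: cvgD; [exact: q3|apply: cvgM; [exact: cvg_cst|exact: pu]].
- by apply: cvgB; [exact: p3|apply: cvgM; [exact: cvg_cst|exact: qu]].
Qed.

Lemma density_measurable (t om k : R) (d1 d2 d3 u : mR3 R -> R[i]) : 0 < k ->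
  cmeasurable (Lay t) d1 -> cmeasurable (Lay t) d2 -> cmeasurable (Lay t) d3 ->
    cmeasurable (Lay t) u ->
  measurable_fun (Lay t) (fun p => density (p.1.1 / k) om (d1 p) (d2 p) (d3 p) (u p)).
Proof.
move=> k0 [p1 q1] [p2 q2] [p3 q3] [pu qu].
under eq_fun do rewrite densityE.
have mr : measurable_fun (Lay t) (fun p : mR3 R => p.1.1 / k).
  apply: measurable_funTS; apply: measurable_funM => //.
  by apply: measurableT_comp => //; exact: measurable_fst.
have mri : measurable_fun (Lay t) (fun p : mR3 R => (p.1.1 / k)^-1).
  apply: (@measurable_comp _ _ _ _ _ _ (`]0, +oo[%classic : set (measurableTypeR R))
    (fun x => x^-1)) => //.
  - by move=> _ [p [Gp _] <-] /=; rewrite in_itv/= andbT divr_gt0// (Gui_r_gt0 Gp).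
  - by apply: measurable_invr_pos => x /=; rewrite in_itv/= andbT.
apply: measurable_funM => //; apply: measurable_funD.
  by apply: measurable_funD; apply: measurable_funD; apply: measurable_funX.
apply: measurable_funM; last exact: measurable_funX.
apply: measurable_funD; apply: measurable_funX.
  by apply: measurable_funD => //; apply: measurable_funM.
by apply: measurable_funB => //; apply: measurable_funM.
Qed.

Lemma ccont_cmeasurable3 (D : set (mR3 R)) (f : R * R * R -> R[i]) : ccont f ->
  cmeasurable (D : set (mR3 R)) (f : mR3 R -> R[i]).
Proof. by move=> [p q]; split; apply: measurable_funTS; apply: continuous_measurable3. Qed.

Lemma cderive_ccont (V : normedModType R) (f : V -> R[i]) (v : V) :
  class_C 1 (fun x => complex.Re (f x)) -> class_C 1 (fun x => complex.Im (f x)) ->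
  ccont (cderive f v).
Proof.
move=> [_ [_ c1]] [_ [_ c2]]; split=> x.
- by have [H _] := c1 v; exact: H.
- by have [H _] := c2 v; exact: H.
Qed.
End lay.

(** * Comparison of the layer forms *)

Section q0_bound.
Context (R : realType).
Notation leb := (@lebesgue_measure R).
Implicit Types (c al be : R).

Lemma trimap_linear c al be (h : R) (u y : R * R) :
  trimap c al be (h *: u + y) = h *: trimap c al be u + trimap c al be y.
Proof.
case: u => u1 u2; case: y => y1 y2; rewrite /trimap.
rewrite -[RHS]/((h * (c * u1) + c * y1, h * (al * u1 + be * u2) + (al * y1 + be * y2))).
rewrite -[LHS]/((c * (h * u1 + y1), al * (h * u1 + y1) + be * (h * u2 + y2))).
by congr pair; ring.
Qed.

Lemma trimapS_linear c al be (h : R) (u y : R * R * R) :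
  trimapS c al be (h *: u + y) = h *: trimapS c al be u + trimapS c al be y.
Proof.
case: u => u1 u2; case: y => y1 y2.
by rewrite -[LHS]/(trimap c al be (h *: u1 + y1), h *: u2 + y2) trimap_linear.
Qed.

Lemma continuous_trimap c al be : continuous (trimap c al be).
Proof.
move=> x; apply: (@cvg_pair _ _ _ (nbhs x) (nbhs (c * x.1)) (nbhs (al * x.1 + be * x.2))).
  by apply: cvgM; [exact: cvg_cst|exact: cvg_fst].
by apply: cvgD; apply: cvgM; [exact: cvg_cst|exact: cvg_fst|exact: cvg_cst|exact: cvg_snd].
Qed.

Lemma continuous_trimapS c al be : continuous (trimapS c al be).
Proof.
move=> p; apply: (@cvg_pair _ _ _ (nbhs p) (nbhs (trimap c al be p.1)) (nbhs p.2));
  last exact: cvg_snd.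
apply: (@cvg_comp _ _ _ fst (trimap c al be) (nbhs p) (nbhs p.1)); first exact: cvg_fst.
exact: continuous_trimap.
Qed.

Lemma cderive_comp_linear (V W : normedModType R) (L : V -> W) (f : W -> R[i]) (v x : V) :
  (forall (h : R) u y, L (h *: u + y) = h *: L u + L y) ->
  cderive (f \o L) v x = cderive f (L v) (L x).
Proof.
move=> linL; rewrite /cderive.
rewrite -(derive_comp_linear (fun y => complex.Re (f y)) v x linL).
by rewrite -(derive_comp_linear (fun y => complex.Im (f y)) v x linL).
Qed.

Lemma complex_lin (a b x y x' y' : R) :
  a%:C%C * (x +i* x')%C + b%:C%C * (y +i* y')%C = ((a * x + b * y) +i* (a * x' + b * y'))%C.
Proof. by apply/eqP; rewrite eq_complex /= !mul0r !subr0 !addr0 !eqxx. Qed.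

Lemma cderive_lin (V : normedModType R) (f : V -> R[i]) (v w x : V) (a b : R) :
  class_C 1 (fun x => complex.Re (f x)) -> class_C 1 (fun x => complex.Im (f x)) ->
  cderive f (a *: v + b *: w) x = a%:C%C * cderive f v x + b%:C%C * cderive f w x.
Proof.
by move=> c1 c2; rewrite /cderive complex_lin !derive_lin.
Qed.

Lemma cderiveZ (V : normedModType R) (f : V -> R[i]) (v x : V) (a : R) :
  class_C 1 (fun x => complex.Re (f x)) -> class_C 1 (fun x => complex.Im (f x)) ->
  cderive f (a *: v) x = a%:C%C * cderive f v x.
Proof.
move=> [_ [d1 _]] [_ [d2 _]]; rewrite /cderive.
have [_ ->] := derivableZ_dir a (d1 x v); have [_ ->] := derivableZ_dir a (d2 x v).
by apply/eqP; rewrite eq_complex /= !mul0r !subr0 !addr0 !eqxx.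
Qed.

(** The angular term alone, times the weight [r]. *)
Lemma density_ge_angular (r om : R) (d1 d2 d3 u : R[i]) : 0 < r ->
  r^-1 * ((complex.Im d3 + om * complex.Re u) ^+ 2
          + (complex.Re d3 - om * complex.Im u) ^+ 2) <=
  density r om d1 d2 d3 u.
Proof.
move=> r0; rewrite densityE.
move: (complex.Im d3 + _) (complex.Re d3 - _) => h1 h2.
move: (complex.Re d1) (complex.Im d1) (complex.Re d2) (complex.Im d2) => x1 y1 x2 y2.
rewrite [leRHS](_ : _ = r^-1 * (h1 ^+ 2 + h2 ^+ 2)
    + (x1 ^+ 2 + y1 ^+ 2 + (x2 ^+ 2 + y2 ^+ 2)) * r); last first.
  by field; rewrite gt_eqF.
by rewrite lerDl mulr_ge0 ?(ltW r0)// !addr_ge0 ?sqr_ge0.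
Qed.

Variables (c al be om om' t t' : R).
Hypotheses (c0 : 0 < c) (be0 : 0 < be) (hom : 0 < om <= 1 / 2).
Hypothesis hG : forall x, Gui t' x <-> Gui t (trimap c al be x).

Lemma Lay_preimage : Lay t' = trimapS c al be @^-1` Lay t.
Proof. by apply/seteqP; split => -[x s] [/= /hG ? ?]. Qed.

Lemma Gui_preimage : Gui t' = trimap c al be @^-1` Gui t.
Proof. by apply/seteqP; split => x /hG. Qed.

Lemma q0_comp_density (w : R * R * R -> R[i]) :
  class_C 1 (fun x => complex.Re (w x)) -> class_C 1 (fun x => complex.Im (w x)) ->
  (q0 om' t' (w \o trimapS c al be) = (c^-1 * be^-1)%:E *
    \int[@leb3 R]_(p in Lay t)
     (density (p.1.1 / c) om' (c%:C%C * cderive w (1, 0, 0) p + al%:C%C * cderive w (0, 1, 0) p)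
        (be%:C%C * cderive w (0, 1, 0) p) (cderive w (0, 0, 1) p) (w p))%:E)%E.
Proof.
move=> w1 w2.
rewrite -[(c^-1 * be^-1)%R in RHS]mul1r.
rewrite -(integral_trimapS al c0 be0)//.
rewrite /q0 Lay_preimage; apply: eq_integral => p _; rewrite mul1e; congr (_%:E).
have L1 : trimapS c al be (1, 0, 0) = c *: (1, 0, 0) + al *: (0, 1, 0).
  rewrite -[RHS]/((c * 1 + al * 0, c * 0 + al * 1), c * 0 + al * 0) /trimapS /trimap/=.
  by rewrite !mulr0 !addr0 !add0r.
have L2 : trimapS c al be (0, 1, 0) = be *: (0, 1, 0).
  rewrite -[RHS]/((be * 0, be * 1), be * 0) /trimapS /trimap/=.
  by rewrite !mulr0 !add0r.
have L3 : trimapS c al be (0, 0, 1) = (0, 0, 1) by rewrite /trimapS /trimap/= !mulr0 addr0.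
rewrite !(cderive_comp_linear _ _ _ (@trimapS_linear c al be)) L1 L2 L3.
rewrite cderive_lin// cderiveZ// /density /= [c * _ / c]mulrAC mulfV ?gt_eqF// mul1r.
by [].
Qed.

(** Composition with the map is bounded for the layer forms, whatever the two
    fluxes: [|u|^2] is integrated fiberwise against the angular term. *)
Lemma q0_comp_le : exists2 C : R, 0 < C & forall w : R * R * R -> R[i],
  class_C 1 (fun x => complex.Re (w x)) -> class_C 1 (fun x => complex.Im (w x)) ->
  (forall x phi, w (x, phi + 2 * pi) = w (x, phi)) ->
  (q0 om' t' (w \o trimapS c al be) <= C%:E * q0 om t w)%E.
Proof.
have [Cp Cp0 poinc] := poincare_twisted hom.
pose A : R := (2 * c ^+ 2 + 2 * al ^+ 2 + be ^+ 2) / c + 2 * c.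
pose B : R := 2 * c * (om - om') ^+ 2.
have A0 : 0 < A.
  rewrite /A ltr_wpDl ?mulr_gt0// divr_ge0 ?(ltW c0)//.
  by repeat first [exact: sqr_ge0 | by [] | apply: addr_ge0 | apply: mulr_ge0].
have B0 : 0 <= B by rewrite /B mulr_ge0 ?sqr_ge0// mulr_ge0// ltW.
exists ((c^-1 * be^-1) * (A + B * Cp)).
  by rewrite mulr_gt0 ?mulr_gt0 ?invr_gt0// ltr_wpDr// mulr_ge0// ltW.
move=> w w1 w2 wper; rewrite q0_comp_density// [in leRHS]EFinM -muleA lee_pmul2l//; last first.
  by rewrite lte_fin mulr_gt0 ?invr_gt0.
have cw : ccont w by split; [case: w1|case: w2].
have cd v : ccont (cderive w v) by exact: cderive_ccont.
have md v : cmeasurable (Lay t : set (mR3 R)) (cderive w v : mR3 R -> R[i])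
  by exact: ccont_cmeasurable3.
have mw : cmeasurable (Lay t : set (mR3 R)) (w : mR3 R -> R[i]) by exact: ccont_cmeasurable3.
have mbe : cmeasurable (Lay t : set (mR3 R)) (fun p : mR3 R => be%:C%C * cderive w (0, 1, 0) p).
  have := cmeasurable_lin 0 be (md (0, 1, 0)) (md (0, 1, 0)).
  by under eq_fun do rewrite mul0r add0r.
set F' := (X in (\int[_]_(p in _) (X p)%:E <= _)%E).
pose F (p : mR3 R) := density p.1.1 om (cderive w (1, 0, 0) p) (cderive w (0, 1, 0) p)
  (cderive w (0, 0, 1) p) (w p).
have A1 := ltW A0; have Cp1 := ltW Cp0.
have ac0 : 0 <= A + B * Cp by apply: addr_ge0 => //; apply: mulr_ge0.
apply: (@Lay_le_fiber R t (A + B * Cp) F F') => //.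
- have := @density_measurable R t om 1 _ _ _ _ ltr01 (md (1, 0, 0)) (md (0, 1, 0))
    (md (0, 0, 1)) mw.
  by under eq_fun do rewrite divr1.
- exact: (density_measurable om' c0 (cmeasurable_lin c al (md (1, 0, 0)) (md (0, 1, 0))) mbe
    (md (0, 0, 1)) mw).
- by move=> x s /Gui_r_gt0 p0; exact: density_ge0.
- by move=> x s /Gui_r_gt0 p0; apply: density_ge0; rewrite divr_gt0.
move=> x /Gui_r_gt0 r0; set r := x.1 in r0.
have cf (v : R * R * R) : ccont (fun s : R => cderive w v ((x : R * R), s)).
  by have [k1 k2] := cd v; split;
    [exact: (continuous_fiber (x:=x) k1)|exact: (continuous_fiber (x:=x) k2)].
have cu : ccont (fun s : R => w ((x : R * R), s)) by have [k1 k2] := cw; split;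
  [exact: (continuous_fiber (x:=x) k1)|exact: (continuous_fiber (x:=x) k2)].
have mc (f : R -> R) : continuous f -> measurable_fun `[0, 2 * pi] (EFin \o f).
  by move=> cf'; apply/measurable_EFinP; apply: measurable_funTS;
    exact: continuous_measurable_fun.
pose a s := complex.Re (w (x, s)); pose b s := complex.Im (w (x, s)).
pose da s := complex.Re (cderive w (0, 0, 1) (x, s)).
pose db s := complex.Im (cderive w (0, 0, 1) (x, s)).
have [cda cdb] := cf (0, 0, 1); have [ca cb] := cu.
pose H s := (db s + om * a s) ^+ 2 + (da s - om * b s) ^+ 2.
have cu2 : continuous (fun s => a s ^+ 2 + b s ^+ 2).
  by move=> s; apply: cvgD; apply: cvgM; [exact: ca|exact: ca|exact: cb|exact: cb].
have cH : continuous H.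
  have k1 : continuous (fun s => db s + om * a s).
    by move=> s; apply: cvgD; [exact: cdb|apply: cvgM; [exact: cvg_cst|exact: ca]].
  have k2 : continuous (fun s => da s - om * b s).
    by move=> s; apply: cvgB; [exact: cda|apply: cvgM; [exact: cvg_cst|exact: cb]].
  by move=> s; apply: cvgD; apply: cvgM; [exact: k1|exact: k1|exact: k2|exact: k2].
have H0 s : 0 <= H s by rewrite /H addr_ge0 ?sqr_ge0.
have u0 s : 0 <= a s ^+ 2 + b s ^+ 2 by rewrite addr_ge0 ?sqr_ge0.
have cF : continuous (fun s : R => F (x, s) : R) by exact: density_continuous.
have cF' : continuous (fun s : R => F' (x, s) : R).
  have cbe : ccont (fun s : R => be%:C%C * cderive w (0, 1, 0) ((x : R * R), s)).
    have := ccont_lin 0 be (cf (0, 1, 0)) (cf (0, 1, 0)).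
    by under eq_fun do rewrite mul0r add0r.
  have cd' := density_continuous (r:=r / c) (om:=om')
    (ccont_lin c al (cf (1, 0, 0)) (cf (0, 1, 0))) cbe (cf (0, 0, 1)) cu.
  by move=> s; exact: (cd' s).
have F0 s : 0 <= F (x, s) by exact: density_ge0.
have Br0 : 0 <= B / r by rewrite divr_ge0// ltW.
have ZI (k : R) (f : R -> R) : 0 <= k -> continuous f -> (forall s, 0 <= f s) ->
    (\int[leb]_(s in `[0%R, (2 * pi)%R]) (k%:E * (f s)%:E) =
     k%:E * \int[leb]_(s in `[0%R, (2 * pi)%R]) (f s)%:E)%E.
  move=> k0 kf f0; apply: ge0_integralZl_EFin => //; first by move=> s _; rewrite lee_fin.
  exact: mc.
have P := poinc a b da db (fun s => derive_fiber x s w1) (fun s => derive_fiber x s w2) cda cdb.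
have per : w (x, 2 * pi) = w (x, 0) by rewrite -[in LHS](add0r (2 * pi)) wper.
have {}P := P (congr1 (@complex.Re R) per) (congr1 (@complex.Im R) per).
apply: (@le_trans _ _ (\int[leb]_(s in `[0%R, (2 * pi)%R])
   (A%:E * (F (x, s))%:E + (B / r)%:E * (a s ^+ 2 + b s ^+ 2)%:E))%E).
  apply: ge0_le_integral => //.
  - by move=> s _; rewrite lee_fin; apply: density_ge0; rewrite divr_gt0.
  - exact: mc.
  - by apply: emeasurable_funD; apply: measurable_funeM; exact: mc.
  - by move=> s _; rewrite -!EFinM -EFinD lee_fin -cnorm2E; exact: density_le.
rewrite ge0_integralD//; first last.
- by apply: measurable_funeM; exact: mc.
- by move=> s _; rewrite -EFinM lee_fin mulr_ge0.
- by apply: measurable_funeM; exact: mc.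
- by move=> s _; rewrite -EFinM lee_fin mulr_ge0// ltW.
rewrite (ZI A _ A1 cF F0) (ZI (B / r) _ Br0 cu2 u0).
have BCp0 : 0 <= B * Cp by apply: mulr_ge0.
rewrite (EFinD A (B * Cp)) (@ge0_muleDl _ _ A%:E (B * Cp)%:E) ?lee_fin//.
apply: leeD => //.
apply: (@le_trans _ _ ((B / r)%:E * (Cp%:E * \int[leb]_(s in `[0%R, (2 * pi)%R]) (H s)%:E))%E).
  by apply: lee_wpmul2l => //; rewrite lee_fin.
rewrite muleA -EFinM (_ : B / r * Cp = (B * Cp) * r^-1); last by rewrite mulrAC.
have ri0 : 0 <= r^-1 by rewrite invr_ge0 ltW.
rewrite EFinM -muleA -(ZI r^-1 H ri0 cH H0).
apply: lee_wpmul2l; first by rewrite lee_fin mulr_ge0// ltW.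
apply: ge0_le_integral => //.
- by move=> s _; rewrite -EFinM lee_fin mulr_ge0// invr_ge0 ltW.
- by apply: measurable_funeM; exact: mc.
- exact: mc.
by move=> s _; rewrite -EFinM lee_fin; exact: density_ge_angular.
Qed.
End q0_bound.

(** * Transport of the form domains *)

Section domains.
Context (R : realType).
Variables (c al be t t' : R).
Hypotheses (c0 : 0 < c) (be0 : 0 < be).
Hypothesis hG : forall x, Gui t' x <-> Gui t (trimap c al be x).

Let K := c^-1 * be^-1.
Let K0 : 0 < K. Proof. by rewrite mulr_gt0 ?invr_gt0. Qed.

Lemma integral_Gui_comp (a : R) (f : R * R -> \bar R) : 0 < a ->
  (\int[@leb2 R]_(x in Gui t') (a%:E * f (trimap c al be x)) =
   (a * K)%:E * \int[@leb2 R]_(x in Gui t) f x)%E.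
Proof.
move=> a0; rewrite (Gui_preimage hG).
exact: integral_trimap.
Qed.

Lemma Rintegral_Gui_comp (a : R) (f : R * R -> R) : 0 < a ->
  \int[@leb2 R]_(x in Gui t') (a * f (trimap c al be x)) =
   a * K * \int[@leb2 R]_(x in Gui t) f x.
Proof.
move=> a0; rewrite (Gui_preimage hG).
exact: Rintegral_trimap.
Qed.

Lemma sqnorm_Gui_comp (u : R * R -> R[i]) :
  (sqnorm (@leb2 R) (Gui t') (fun x => x.1) (u \o trimap c al be) =
   (c^-1 * K)%:E * sqnorm (@leb2 R) (Gui t) (fun x => x.1) u)%E.
Proof.
rewrite /sqnorm -integral_Gui_comp ?invr_gt0//.
by apply: eq_integral => x _; rewrite -EFinM /= [in RHS]mulrA mulKf ?gt_eqF.
Qed.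

Lemma sqnorm_Lay_comp (u : R * R * R -> R[i]) :
  (sqnorm (@leb3 R) (Lay t') (fun p => p.1.1) (u \o trimapS c al be) =
   (c^-1 * K)%:E * sqnorm (@leb3 R) (Lay t) (fun p => p.1.1) u)%E.
Proof.
rewrite /sqnorm (Lay_preimage hG) -(integral_trimapS al c0 be0) ?invr_gt0//.
by apply: eq_integral => x _; rewrite -EFinM /= [in RHS]mulrA mulKf ?gt_eqF.
Qed.

Lemma cmeasurable_Gui_comp (u : R * R -> R[i]) :
  cmeasurable (Gui t : set (mR2 R)) (u : mR2 R -> R[i]) ->
  cmeasurable (Gui t' : set (mR2 R)) ((u \o trimap c al be) : mR2 R -> R[i]).
Proof.
have H (f : mR2 R -> measurableTypeR R) : measurable_fun (Gui t : set (mR2 R)) f ->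
    measurable_fun (Gui t' : set (mR2 R)) (f \o (trimap c al be : mR2 R -> mR2 R)).
  move=> mf; apply: (@measurable_comp _ _ _ _ _ _ (Gui t : set (mR2 R))) => //.
  - exact: Gui_measurable.
  - by move=> _ [x /hG ? <-].
  - by apply: measurable_funTS; exact: measurable_trimap.
by move=> [m1 m2]; split; [exact: (H _ m1)|exact: (H _ m2)].
Qed.

Lemma cmeasurable_Lay_comp (u : R * R * R -> R[i]) :
  cmeasurable (Lay t : set (mR3 R)) (u : mR3 R -> R[i]) ->
  cmeasurable (Lay t' : set (mR3 R)) ((u \o trimapS c al be) : mR3 R -> R[i]).
Proof.
have H (f : mR3 R -> measurableTypeR R) : measurable_fun (Lay t : set (mR3 R)) f ->
    measurable_fun (Lay t' : set (mR3 R)) (f \o (trimapS c al be : mR3 R -> mR3 R)).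
  move=> mf; apply: (@measurable_comp _ _ _ _ _ _ (Lay t : set (mR3 R))) => //.
  - exact: Lay_measurable.
  - by rewrite (Lay_preimage hG) => _ [x ? <-].
  - by apply: measurable_funTS; exact: measurable_trimapS.
by move=> [m1 m2]; split; [exact: (H _ m1)|exact: (H _ m2)].
Qed.

Lemma L2Gui_comp (u : R * R -> R[i]) : L2Gui t u -> L2Gui t' (u \o trimap c al be).
Proof.
move=> [m s]; split; first exact: cmeasurable_Gui_comp.
by rewrite sqnorm_Gui_comp lte_mul_pinfty// lee_fin ltW// mulr_gt0 ?invr_gt0.
Qed.

Lemma L2cyl_comp (u : R * R * R -> R[i]) : L2cyl t u -> L2cyl t' (u \o trimapS c al be).
Proof.
move=> [m s]; split; first exact: cmeasurable_Lay_comp.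
by rewrite sqnorm_Lay_comp lte_mul_pinfty// lee_fin ltW// mulr_gt0 ?invr_gt0.
Qed.

Lemma smooth_comp_linear (V W : normedModType R) (L : V -> W) (u : W -> R[i]) :
  (forall (h : R) u y, L (h *: u + y) = h *: L u + L y) -> continuous L ->
  smooth u -> smooth (u \o L).
Proof.
by move=> linL cL su n; have [s1 s2] := su n; split;
  [exact: (class_C_comp_linear linL cL s1)|exact: (class_C_comp_linear linL cL s2)].
Qed.

Lemma compact_trimap_preimage (A : set (R * R)) : compact A -> A `<=` Gui t ->
  compact (trimap c al be @^-1` A) /\ trimap c al be @^-1` A `<=` Gui t'.
Proof.
move=> cA AG; split; last by move=> x /= /AG; rewrite hG.
rewrite (_ : _ @^-1` A = triinv c al be @` A).
  by apply: continuous_compact => //; apply: continuous_subspaceT; exact: continuous_trimap.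
apply/seteqP; split => [x Ax|_ [x Ax <-]] /=.
  by exists (trimap c al be x) => //; rewrite trimapK.
by rewrite triinvK.
Qed.

Lemma test_Lay_comp (u : R * R * R -> R[i]) : test_Lay t u ->
  test_Lay t' (u \o trimapS c al be).
Proof.
move=> [su pu [A [cA AG uA]]]; split.
- apply: smooth_comp_linear => //; [exact: trimapS_linear|exact: continuous_trimapS].
- by move=> x phi; rewrite /= /trimapS /= pu.
- have [cA' AG'] := compact_trimap_preimage cA AG.
  by exists (trimap c al be @^-1` A); split=> // x phi nA; exact: uA.
Qed.

Lemma test_Gui_comp (u : R * R -> R[i]) : test_Gui t u -> test_Gui t' (u \o trimap c al be).
Proof.
move=> [su [A [cA AG uA]]]; split.
- apply: smooth_comp_linear => //; [exact: trimap_linear|exact: continuous_trimap].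
- have [cA' AG'] := compact_trimap_preimage cA AG.
  by exists (trimap c al be @^-1` A); split=> // x nA; exact: uA.
Qed.

Lemma smoothB (V : normedModType R) (u v : V -> R[i]) : smooth u -> smooth v ->
  smooth (fun x => u x - v x).
Proof.
move=> su sv n; have [u1 u2] := su n; have [v1 v2] := sv n; split.
- rewrite (_ : (fun x => _) = (fun x => complex.Re (u x)) - (fun x => complex.Re (v x)));
    first exact: class_CB.
  apply/funext => x; rewrite -[RHS]/(complex.Re (u x) - complex.Re (v x)).
  by case: (u x) => ? ?; case: (v x).
- rewrite (_ : (fun x => _) = (fun x => complex.Im (u x)) - (fun x => complex.Im (v x)));
    first exact: class_CB.
  apply/funext => x; rewrite -[RHS]/(complex.Im (u x) - complex.Im (v x)).
  by case: (u x) => ? ?; case: (v x).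
Qed.

Lemma domQ_comp (om om' : R) (u : R * R * R -> R[i]) : 0 < om <= 1 / 2 ->
  domQ om t u -> domQ om' t' (u \o trimapS c al be).
Proof.
move=> hom [uL [un [tun cvun cau]]]; split; first exact: L2cyl_comp.
exists (fun n => un n \o trimapS c al be); split.
- by move=> n; exact: test_Lay_comp.
- rewrite (_ : (fun n => _) = (fun n => (c^-1 * K)%:E * sqnorm (@leb3 R) (Lay t) (fun p =>
    p.1.1)
                    (fun p => un n p - u p)%R)%E); last first.
    by apply/funext => n; rewrite -sqnorm_Lay_comp.
  by rewrite -(mule0 (c^-1 * K)%:E); exact: cvgeZl.
- have [C C0 HC] := q0_comp_le om' c0 be0 hom hG.
  move=> e e0; have eC : 0 < e / C by rewrite divr_gt0.
  have [N HN] := cau _ eC; exists N => n m Nn Nm.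
  pose w p := un n p - un m p.
  have [sn pn _] := tun n; have [sm pm _] := tun m.
  have sw : smooth w by exact: smoothB.
  have [w1 w2] := sw 1%N.
  apply: (@le_lt_trans _ _ (C%:E * q0 om t w)%E).
    by apply: (HC w w1 w2) => x phi; rewrite /w pn pm.
  by rewrite muleC -lte_pdivlMr// muleC -EFinM mulrC HN.
Qed.

Lemma ae_trimap_comp (P : R * R -> Prop) :
  {ae @leb2 R, forall x, P x} -> {ae @leb2 R, forall x, P (trimap c al be x)}.
Proof.
move=> [N [mN N0 PN]]; exists (trimap c al be @^-1` N); split.
- by rewrite -[X in measurable X]setTI; exact: (measurable_trimap c al be measurableT).
- have := trimap_scales al c0 be0 mN; rewrite /leb2 in N0 *; move=> ->.
  by rewrite [X in (_ * X)%E]N0 mule0.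
- by move=> x /= nP; exact: PN.
Qed.

Lemma domf_comp (om om' : R) (v : R * R -> R[i]) : 0 < om <= 1 / 2 ->
  domf om t v -> domf om' t' (v \o trimap c al be).
Proof.
move=> hom [vL [u uQ vu]]; split; first exact: L2Gui_comp.
exists (u \o trimapS c al be); first exact: (domQ_comp om' hom uQ).
have [N [mN N0 PN]] := ae_trimap_comp vu; exists N; split => // x /= nP.
by apply: PN => /= H; apply: nP => /hG; exact: H.
Qed.
End domains.

(** * Locally integrable functions and weak derivatives *)

Section weak.
Context (R : realType).
Implicit Types (t a b : R).

Lemma compact2_measurable (A : set (R * R)) : compact A -> measurable (A : set (mR2 R)).
Proof.
move=> cA; rewrite -[A]setCK; apply: measurableC; apply: open_measurable2.
rewrite openC; apply: compact_closed => //; exact: norm_hausdorff.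
Qed.

Lemma normcE (z : R[i]) :
  normc z = Num.sqrt (complex.Re z ^+ 2 + complex.Im z ^+ 2).
Proof. by case: z. Qed.

Lemma normc_ge0 (z : R[i]) : 0 <= normc z.
Proof. by rewrite normcE sqrtr_ge0. Qed.

Lemma Re_le_normc (z : R[i]) : `|complex.Re z| <= normc z.
Proof. by rewrite normcE -sqrtr_sqr ler_sqrt ?addr_ge0 ?sqr_ge0// lerDl sqr_ge0. Qed.

Lemma Im_le_normc (z : R[i]) : `|complex.Im z| <= normc z.
Proof. by rewrite normcE -sqrtr_sqr ler_sqrt ?addr_ge0 ?sqr_ge0// lerDr sqr_ge0. Qed.

Lemma normc_lin_le (a b : R) (z w : R[i]) :
  normc (a%:C%C * z + b%:C%C * w) <=
  `|a| * normc z + `|b| * normc w.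
Proof.
have E (k : R) (y : R[i]) : normc (k%:C%C * y) = `|k| * normc y.
  rewrite !normcE Re_realM Im_realM !exprMn -mulrDr sqrtrM ?sqr_ge0//.
  by rewrite sqrtr_sqr.
by rewrite -!E; exact: le_normcD.
Qed.

Lemma measurable_normc d (T : measurableType d) (D : set T) (u : T -> R[i]) :
  cmeasurable D u -> measurable_fun D (fun x => normc (u x)).
Proof.
move=> [m1 m2]; under eq_fun do rewrite normcE.
apply: (@measurableT_comp _ _ _ _ _ _ (@Num.sqrt R : measurableTypeR R -> measurableTypeR R)).
  by apply: continuous_measurable_fun; exact: sqrt_continuous.
by apply: measurable_funD; apply: measurable_funX.
Qed.

Lemma cmeasurableS d (T : measurableType d) (D E : set T) (u : T -> R[i]) :
  measurable E -> D `<=` E -> cmeasurable E u -> cmeasurable D u.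
Proof. by move=> mE DE [m1 m2]; split; apply: (measurable_funS mE DE). Qed.

Lemma L1loc_lin (t a b : R) (f g : R * R -> R[i]) : L1loc_Gui t f -> L1loc_Gui t g ->
  L1loc_Gui t (fun x => a%:C%C * f x + b%:C%C * g x).
Proof.
move=> [mf If] [mg Ig]; split; first exact: cmeasurable_lin.
move=> A cA AG; have mA := compact2_measurable cA.
have mfA := cmeasurableS (Gui_measurable t) AG mf.
have mgA := cmeasurableS (Gui_measurable t) AG mg.
have m1 := measurable_normc mfA; have m2 := measurable_normc mgA.
have m3 := measurable_normc (cmeasurable_lin a b mfA mgA).
apply: (@le_lt_trans _ _ (\int[@leb2 R]_(x in A) (`|a|%:E * (normc (f x))%:E
   + `|b|%:E * (normc (g x))%:E))%E).
  apply: ge0_le_integral => //.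
  - by move=> x _; rewrite lee_fin normc_ge0.
  - exact/measurable_EFinP.
  - by apply: emeasurable_funD; apply: measurable_funeM; exact/measurable_EFinP.
  - by move=> x _; rewrite -!EFinM -EFinD lee_fin normc_lin_le.
rewrite ge0_integralD//; first last.
- by apply: measurable_funeM; exact/measurable_EFinP.
- by move=> x _; rewrite -EFinM lee_fin mulr_ge0// normc_ge0.
- by apply: measurable_funeM; exact/measurable_EFinP.
- by move=> x _; rewrite -EFinM lee_fin mulr_ge0// normc_ge0.
rewrite !ge0_integralZl_EFin//; try by [exact/measurable_EFinP|move=> x _;
  rewrite lee_fin normc_ge0].
by rewrite lte_add_pinfty// lte_mul_pinfty ?lee_fin//; [exact: If|exact: Ig].
Qed.

Section pullback.
Variables (c al be t t' : R).
Hypotheses (c0 : 0 < c) (be0 : 0 < be).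
Hypothesis hG : forall x, Gui t' x <-> Gui t (trimap c al be x).

Lemma L1loc_comp (u : R * R -> R[i]) : L1loc_Gui t u -> L1loc_Gui t' (u \o trimap c al be).
Proof.
move=> [mu Iu]; split; first exact: (cmeasurable_Gui_comp hG mu).
move=> A cA AG.
have cA' : compact (trimap c al be @` A).
  by apply: continuous_compact => //; apply: continuous_subspaceT; exact: continuous_trimap.
have AG' : trimap c al be @` A `<=` Gui t by move=> _ [x /AG + <-]; rewrite hG.
have E : A = trimap c al be @^-1` (trimap c al be @` A).
  apply/seteqP; split => [x Ax|x [y Ay /(can_inj (trimapK al c0 be0)) <-]] //.
  by exists x.
rewrite E; have := integral_trimap al c0 be0 ltr01
  (trimap c al be @` A) (fun x => (normc (u x))%:E).
under eq_integral do rewrite mul1e.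
move=> ->; rewrite lte_mul_pinfty ?lee_fin ?mul1r ?mulr_ge0 ?invr_ge0 ?(ltW c0) ?(ltW be0)//.
exact: Iu.
Qed.

Lemma cintegral_Gui_comp (f : R * R -> R[i]) :
  cintegral (@leb2 R) (Gui t') (f \o trimap c al be) =
  (c^-1 * be^-1)%:C%C * cintegral (@leb2 R) (Gui t) f.
Proof.
have E (h : R * R -> R) : \int[@leb2 R]_(x in Gui t') h (trimap c al be x) =
    c^-1 * be^-1 * \int[@leb2 R]_(x in Gui t) h x.
  rewrite -[c^-1 * be^-1]mul1r -(Rintegral_Gui_comp c0 be0 hG)//.
  by apply: eq_Rintegral => x _; rewrite mul1r.
rewrite /cintegral (E (fun x => complex.Re (f x))) (E (fun x => complex.Im (f x))).
by apply/eqP; rewrite eq_complex /= !mul0r subr0 addr0 !eqxx.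
Qed.
End pullback.

(** [g] is bounded on [A], and [f g] vanishes off [A]. *)
Lemma integrable_compact_support (t : R) (A : set (R * R)) (f g : R * R -> R) :
  compact A -> A `<=` Gui t ->
  measurable_fun (Gui t : set (mR2 R)) (f : mR2 R -> R) ->
  (\int[@leb2 R]_(x in A) `|f x|%:E < +oo)%E ->
  continuous g -> (forall x, ~ A x -> g x = 0) ->
  (@leb2 R).-integrable (Gui t) (EFin \o (fun x => f x * g x)).
Proof.
move=> cA AG mf If cg gA; have mA := compact2_measurable cA.
have mfA : measurable_fun (A : set (mR2 R)) f.
  exact: measurable_funS (Gui_measurable t) AG mf.
have mgA : measurable_fun (A : set (mR2 R)) (g : mR2 R -> R).
  by apply: measurable_funTS; exact: continuous_measurable2.
have /compact_bounded[M [_ HM]] : compact (g @` A).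
  by apply: continuous_compact => //; exact: continuous_subspaceT.
have {}HM x : A x -> `|g x| <= `|M| + 1.
  move=> Ax; apply: (HM (`|M| + 1)); last by exists x.
  by rewrite (le_lt_trans (ler_norm _))// ltrDl.
rewrite (_ : EFin \o _ = (EFin \o (fun x => f x * g x)) \_ A); last first.
  apply/funext => x; rewrite patchE; case: ifPn => // /negP; rewrite inE => nA.
  by rewrite /= gA// mulr0.
apply/integrable_restrict => //; first exact: Gui_measurable.
rewrite setIidr//.
have fA : (@leb2 R).-integrable (A : set (mR2 R)) (EFin \o f).
  by apply/integrableP; split; [exact/measurable_EFinP|under eq_integral do rewrite abse_EFin].
apply: (le_integrable mA _ _ (integrableZl mA (`|M| + 1) fA)).
  by apply/measurable_EFinP; apply: measurable_funM.
move=> x Ax; rewrite /= lee_fin !normrM mulrC ler_wpM2r//.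
by rewrite [leRHS]ger0_norm ?addr_ge0// HM.
Qed.

Lemma L1loc_parts (t : R) (A : set (R * R)) (u : R * R -> R[i]) :
  L1loc_Gui t u -> compact A -> A `<=` Gui t ->
  ((\int[@leb2 R]_(x in A) `|complex.Re (u x)|%:E < +oo)%E *
  (\int[@leb2 R]_(x in A) `|complex.Im (u x)|%:E < +oo)%E)%type.
Proof.
move=> [mu Iu] cA AG; have mA := compact2_measurable cA.
have mA' := cmeasurableS (Gui_measurable t) AG mu.
have m1 := measurable_normc mA'; have [m2 m3] := mA'.
split; apply: (le_lt_trans _ (Iu A cA AG)); apply: ge0_le_integral => //.
- by apply/measurable_EFinP; apply: measurableT_comp.
- exact/measurable_EFinP.
- by move=> x _; rewrite lee_fin Re_le_normc.
- by apply/measurable_EFinP; apply: measurableT_comp.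
- exact/measurable_EFinP.
- by move=> x _; rewrite lee_fin Im_le_normc.
Qed.

(** Integrability over the guide of the real and imaginary parts. *)
Definition cintegrable (t : R) (f : R * R -> R[i]) :=
  (@leb2 R).-integrable (Gui t) (EFin \o (fun x => complex.Re (f x))) /\
  (@leb2 R).-integrable (Gui t) (EFin \o (fun x => complex.Im (f x))).

Lemma cintegrable_L1loc (t : R) (A : set (R * R)) (u g : R * R -> R[i]) :
  L1loc_Gui t u -> compact A -> A `<=` Gui t -> ccont g -> (forall x, ~ A x -> g x = 0) ->
  cintegrable t (fun x => u x * g x).
Proof.
move=> Lu cA AG [c1 c2] gA; have [[m1 m2] _] := Lu; have [I1 I2] := L1loc_parts Lu cA AG.
have g1 x : ~ A x -> complex.Re (g x) = 0 by move=> /gA ->.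
have g2 x : ~ A x -> complex.Im (g x) = 0 by move=> /gA ->.
have mG := Gui_measurable t.
split.
- rewrite (_ : EFin \o _ = (EFin \o (fun x => complex.Re (u x) * complex.Re (g x))%R) \-
    (EFin \o (fun x => complex.Im (u x) * complex.Im (g x))%R))%E; last first.
    by apply/funext => x /=; rewrite -EFinB; case: (u x); case: (g x).
  by apply: integrableB => //; apply: (integrable_compact_support cA AG).
- rewrite (_ : EFin \o _ = (EFin \o (fun x => complex.Re (u x) * complex.Im (g x))%R) \+
    (EFin \o (fun x => complex.Im (u x) * complex.Re (g x))%R))%E; last first.
    by apply/funext => x /=; rewrite -EFinD; case: (u x); case: (g x).
  by apply: integrableD => //; apply: (integrable_compact_support cA AG).
Qed.

Lemma cintegral_lin (t a b : R) (f g : R * R -> R[i]) : cintegrable t f -> cintegrable t g ->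
  cintegral (@leb2 R) (Gui t) (fun x => a%:C%C * f x + b%:C%C * g x) =
  a%:C%C * cintegral (@leb2 R) (Gui t) f + b%:C%C * cintegral (@leb2 R) (Gui t) g.
Proof.
move=> [f1 f2] [g1 g2]; have mG := Gui_measurable t.
have Z (k : R) (h : R * R -> R) : (@leb2 R).-integrable (Gui t) (EFin \o h) ->
    (@leb2 R).-integrable (Gui t) (EFin \o (fun x => k * h x)).
  by move=> ih; have := integrableZl mG k ih.
rewrite /cintegral complex_lin; congr (_ +i* _)%C.
- under eq_Rintegral do rewrite ReD !Re_realM.
  by rewrite RintegralD ?RintegralZl//; exact: Z.
- under eq_Rintegral do rewrite ImD !Im_realM.
  by rewrite RintegralD ?RintegralZl//; exact: Z.
Qed.

Lemma derive_off_compact (f : R * R -> R) (v : R * R) (A : set (R * R)) x :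
  compact A -> (forall y, ~ A y -> f y = 0) -> ~ A x -> 'D_v f x = 0.
Proof.
move=> cA fA nAx.
have oA : open (~` A).
  by rewrite openC; apply: compact_closed => //; exact: norm_hausdorff.
apply: lim_near_cst => //.
have cl : (fun h : R => h *: v + x) @ (0 : R) --> x.
  have : (fun h : R => h *: v + x) @ (0 : R) --> (0 : R) *: v + x.
    by apply: cvgD; [apply: cvgZr_tmp; exact: cvg_id|exact: cvg_cst].
  by rewrite scale0r add0r.
have H : \forall h \near (0 : R), ~ A (h *: v + x).
  exact: (cl _ (open_nbhs_nbhs (conj oA nAx))).
have H' : \forall h \near (0 : R)^', ~ A (h *: v + x) by exact: nbhs_dnbhs H.
near=> h; rewrite /= !fA//; last by near: h.
by rewrite subrr scaler0.
Unshelve. all: by end_near. Qed.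

Lemma cderive_off_compact (f : R * R -> R[i]) (v : R * R) (A : set (R * R)) x :
  compact A -> (forall y, ~ A y -> f y = 0) -> ~ A x -> cderive f v x = 0.
Proof.
move=> cA fA nAx; rewrite /cderive.
rewrite (@derive_off_compact _ v A)//; last by move=> y /fA ->.
by rewrite (@derive_off_compact _ v A)//; move=> y /fA ->.
Qed.

End weak.

(** * Transport of the quadratic form *)

Section forms.
Context (R : realType).
Variables (c al be t t' : R).
Hypotheses (c0 : 0 < c) (be0 : 0 < be).
Hypothesis hG : forall x, Gui t' x <-> Gui t (trimap c al be x).

Lemma Gui_inv x : Gui t x <-> Gui t' (triinv c al be x).
Proof. by rewrite hG triinvK. Qed.

(** If [M] sends the direction [e] to [a e1 + b e2], the weak derivative of
    [u \o M] along [e] is [(a u_r + b u_z) \o M]: a test function on the source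
    guide is [z \o M] for a test function [z] on the target. *)
Lemma weak_derivative_comp (a b : R) (e : R * R) (u gr gz : R * R -> R[i]) :
  trimap c al be e = a *: (1, 0) + b *: (0, 1) ->
  weak_derivative t (1, 0) u gr -> weak_derivative t (0, 1) u gz ->
  weak_derivative t' e (u \o trimap c al be)
    ((fun x => a%:C%C * gr x + b%:C%C * gz x) \o trimap c al be).
Proof.
move=> Me [Lu Lr Hr] [_ Lz Hz]; split.
- exact: (L1loc_comp c0 be0 hG Lu).
- exact: (L1loc_comp c0 be0 hG (L1loc_lin a b Lr Lz)).
move=> eta teta.
pose z := eta \o triinv c al be.
have tz : test_Gui t z.
  by apply: (@test_Gui_comp _ _ _ _ t' t _ _ Gui_inv); rewrite ?invr_gt0.
have etaE : eta = z \o trimap c al be by apply/funext => x; rewrite /z /= trimapK.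
have [sz [A [cA AG zA]]] := tz.
have [z1 z2] := sz 1%N.
have cz : ccont z by split; [case: z1|case: z2].
have cdz v : ccont (cderive z v) by exact: cderive_ccont.
have dzA v x : ~ A x -> cderive z v x = 0 by move=> nA; exact: (cderive_off_compact v cA zA nA).
rewrite (_ : (fun x => (u \o trimap c al be) x * cderive eta e x) =
    (fun y => a%:C%C * (u y * cderive z (1, 0) y) + b%:C%C * (u y * cderive z (0, 1) y))
      \o trimap c al be); last first.
  apply/funext => x; rewrite /= [in LHS]etaE.
  rewrite (cderive_comp_linear _ _ _ (@trimap_linear R c al be)) Me cderive_lin//.
  by rewrite mulrDr !(mulrCA (u _)).
rewrite (_ : (fun x => ((fun x => a%:C%C * gr x + b%:C%C * gz x) \o trimap c al be) x * eta x) =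
    (fun y => a%:C%C * (gr y * z y) + b%:C%C * (gz y * z y)) \o trimap c al be); last first.
  by apply/funext => x; rewrite /= [in LHS]etaE /= mulrDl !mulrA.
rewrite !(cintegral_Gui_comp c0 be0 hG).
rewrite (cintegral_lin a b (cintegrable_L1loc Lu cA AG (cdz (1, 0)) (dzA (1, 0)))
  (cintegrable_L1loc Lu cA AG (cdz (0, 1)) (dzA (0, 1)))).
rewrite (cintegral_lin a b (cintegrable_L1loc Lr cA AG cz zA)
  (cintegrable_L1loc Lz cA AG cz zA)).
by rewrite Hr// Hz// !mulrN -opprD mulrN.
Qed.

Lemma innerGui_comp (f g : R * R -> R[i]) :
  innerGui t' (f \o trimap c al be) (g \o trimap c al be) =
  (c^-1 * (c^-1 * be^-1))%:C%C * innerGui t f g.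
Proof.
have ci : 0 < c^-1 by rewrite invr_gt0.
rewrite /innerGui /inner /cintegral.
have E (h : R[i] -> R) : (forall k z, h (k%:C%C * z) = k * h z) ->
    \int[@leb2 R]_(x in Gui t') h ((x.1)%:C%C * (conjc (f (trimap c al be x))
      * g (trimap c al be x))) =
    c^-1 * (c^-1 * be^-1) * \int[@leb2 R]_(x in Gui t) h ((x.1)%:C%C * (conjc (f x) * g x)).
  move=> hk; rewrite -(Rintegral_Gui_comp c0 be0 hG)//; apply: eq_Rintegral => x _.
  by rewrite !hk /= mulrA mulKf ?gt_eqF.
rewrite (E _ (@Re_realM R)) (E _ (@Im_realM R)).
by apply/eqP; rewrite eq_complex /= !mul0r subr0 addr0 !eqxx.
Qed.

Lemma Re_innerGui_ge0 (s : R) (f : R * R -> R[i]) : 0 <= complex.Re (innerGui s f f).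
Proof.
apply: Rintegral_ge0 => x /Gui_r_gt0 x0; rewrite Re_realM mulr_ge0 ?(ltW x0)//.
by case: (f x) => a b; rewrite /= mulNr opprK addr_ge0 -?expr2 ?sqr_ge0.
Qed.

End forms.

(** * Geometry of the guides *)

Section geometry.
Context (R : realType).

(** The guide is the part [0 < r] of the strip [0 < r cos th - z sin th < pi]; the
    lower bound on [z] in the definition is implied. *)
Lemma GuiE (th : R) (x : R * R) : 0 < th < pi / 2 ->
  Gui th x <-> 0 < x.1 /\ 0 < x.1 * cos th - x.2 * sin th < pi.
Proof.
move=> /andP[th0 th1]; have p0 := pi_gt0 R.
have s0 : 0 < sin th by rewrite sin_gt0_pi// th0 (lt_trans th1)// ltr_pdivrMr// ltr_pMr// ltr1n.
have cs0 : 0 < cos th by rewrite cos_gt0_pihalf// th1 (lt_trans _ th0)// oppr_lt0 divr_gt0.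
case: x => r z; rewrite /Gui/= gt_max /tan.
have e1 : (z * (sin th / cos th) < r) = (0 < r * cos th - z * sin th).
  by rewrite mulrA ltr_pdivrMr// subr_gt0.
have e2 : (r < z * (sin th / cos th) + pi / cos th) = (r * cos th - z * sin th < pi).
  by rewrite mulrA -mulrDl ltr_pdivlMr// ltrBlDl.
have e3 : (- (pi / sin th) < z) = (- pi < z * sin th).
  by rewrite -mulNr ltr_pdivrMr.
rewrite e1 e2 e3; split.
  by move=> [r0 _ /andP[_ h1] h2]; split => //; rewrite h1.
move=> [r0 /andP[h1 h2]]; split => //; last by rewrite r0.
have : 0 < r * cos th by rewrite mulr_gt0.
lra.
Qed.

End geometry.

(** * Comparison of the Rayleigh quotients *)

Section comparison.
Context (R : realType).
Variables (c al be om om' t t' : R).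
Hypotheses (c0 : 0 < c) (be0 : 0 < be).
Hypothesis hG : forall x, Gui t' x <-> Gui t (trimap c al be x).

(** If the gradient is contracted and [om' / r' <= om / r] at corresponding
    points, the form does not increase relative to the norm.  Both carry
    the factor [c^-2 be^-1]: [c^-1 be^-1] from the measure, [c^-1] from the weight
    [r]. *)
Lemma form_comp_le (u : R * R -> R[i]) (y : \bar R) :
  (forall X Y : R, (c * X + al * Y) ^+ 2 + (be * Y) ^+ 2 <= X ^+ 2 + Y ^+ 2) ->
  0 <= om' -> c * om' <= om -> cmeasurable (Gui t : set (mR2 R)) (u : mR2 R -> R[i]) ->
  form_f om t u y ->
  exists2 y' : \bar R, form_f om' t' (u \o trimap c al be) y' &
    (y' <= (c^-1 * (c^-1 * be^-1))%:E * y)%E.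
Proof.
move=> contr om'0 comom mu [gr [gz [wr wz ->]]].
have ci : 0 < c^-1 by rewrite invr_gt0.
have M1 : trimap c al be (1, 0) = c *: (1, 0) + al *: (0, 1).
  by rewrite -[RHS]/(c * 1 + al * 0, c * 0 + al * 1) /trimap/= !mulr0 !addr0 add0r.
have M2 : trimap c al be (0, 1) = 0 *: (1, 0) + be *: (0, 1).
  by rewrite -[RHS]/(0 * 1 + be * 0, 0 * 0 + be * 1) /trimap/= !mulr0 !mul0r !add0r.
have w1 := weak_derivative_comp c0 be0 hG M1 wr wz.
have w2 := weak_derivative_comp c0 be0 hG M2 wr wz.
eexists; first by eexists; eexists; split; [exact: w1|exact: w2|reflexivity].
pose F (x : R * R) :=
  (cnorm2 (c%:C%C * gr x + al%:C%C * gz x) + cnorm2 (0%:C%C * gr x + be%:C%C * gz x)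
   + om' ^+ 2 / (x.1 / c) ^+ 2 * cnorm2 (u x)) * x.1.
rewrite (_ : (\int[_]_(x in _) _)%E = \int[@leb2 R]_(x in Gui t')
  (c^-1%:E * (F (trimap c al be x))%:E))%E; last first.
  apply: eq_integral => x _; rewrite -EFinM /F /=.
  rewrite [c * x.1 / c]mulrAC mulfV ?gt_eqF// mul1r; congr (_%:E).
  by rewrite [in RHS](mulrCA c^-1) mulKf ?gt_eqF.
rewrite (integral_Gui_comp c0 be0 hG (fun x => (F x)%:E))//.
have K0 : 0 < c^-1 * (c^-1 * be^-1) by rewrite !mulr_gt0 ?invr_gt0.
rewrite lee_pmul2l//.
have [_ [mr _] _] := wr; have [_ [mz _] _] := wz.
have mN (f : mR2 R -> R[i]) : cmeasurable (Gui t : set (mR2 R)) f ->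
    measurable_fun (Gui t : set (mR2 R)) (fun x => cnorm2 (f x)).
  move=> [m1 m2]; under eq_fun do rewrite cnorm2E.
  by apply: measurable_funD; apply: measurable_funX.
have mx : measurable_fun (Gui t : set (mR2 R)) (fun x : mR2 R => x.1)
  by apply: measurable_funTS; exact: measurable_fst.
have mxi (k : R) : 0 < k ->
    measurable_fun (Gui t : set (mR2 R)) (fun x : mR2 R => (x.1 / k)^-1).
  move=> k0.
  apply: (@measurable_comp _ _ _ _ _ _ (`]0, +oo[%classic : set (measurableTypeR R))
    (fun x => x^-1)) => //.
  - by move=> _ [p Gp <-] /=; rewrite in_itv/= andbT divr_gt0// (Gui_r_gt0 Gp).
  - by apply: measurable_invr_pos => x /=; rewrite in_itv/= andbT.
  - by apply: measurable_funM.
have mF (k : R) (o : R) (f g : mR2 R -> R[i]) : 0 < k ->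
   cmeasurable (Gui t : set (mR2 R)) f -> cmeasurable (Gui t : set (mR2 R)) g ->
   measurable_fun (Gui t : set (mR2 R)) (fun x : mR2 R =>
     (cnorm2 (f x) + cnorm2 (g x) + o ^+ 2 / (x.1 / k) ^+ 2 * cnorm2 (u x)) * x.1).
  move=> k0 m1 m2; apply: measurable_funM => //; apply: measurable_funD.
    by apply: measurable_funD; exact: mN.
  apply: measurable_funM; last exact: mN.
  apply: measurable_funM => //; under eq_fun do rewrite -exprVn.
  by apply: measurable_funX; exact: mxi.
apply: ge0_le_integral.
- exact: Gui_measurable.
- move=> x /Gui_r_gt0 x0; rewrite lee_fin /F.
  have x1 := ltW x0; have xi : 0 <= (((x.1 : R) / c) ^+ 2)^-1 by rewrite invr_ge0 sqr_ge0.
  by repeat first [exact: cnorm2_ge0 | exact: sqr_ge0 | by [] | apply: addr_ge0 | apply: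
    mulr_ge0].
- apply/measurable_EFinP; apply: mF => //; exact: cmeasurable_lin.
- apply/measurable_EFinP; have := mF 1 om gr gz ltr01 mr mz.
  by under eq_fun do rewrite divr1.
move=> x /Gui_r_gt0 x0; rewrite lee_fin ler_wpM2r ?(ltW x0)//; apply: lerD.
  rewrite !cnorm2E !ReD !ImD !Re_realM !Im_realM !mul0r !add0r.
  have := contr (complex.Re (gr x)) (complex.Re (gz x)).
  have := contr (complex.Im (gr x)) (complex.Im (gz x)).
  set p1 := (c * complex.Im _ + _) ^+ 2; set p2 := (be * complex.Im _) ^+ 2.
  set p3 := (c * complex.Re _ + _) ^+ 2; set p4 := (be * complex.Re _) ^+ 2.
  by lra.
rewrite ler_wpM2r ?cnorm2_ge0//.
have -> : om' ^+ 2 / (x.1 / c) ^+ 2 = (c * om') ^+ 2 / x.1 ^+ 2.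
  by field; rewrite !gt_eqF.
rewrite ler_wpM2r ?invr_ge0 ?sqr_ge0// ler_sqr ?nnegrE//.
  by rewrite mulr_ge0// ltW.
by apply: le_trans comom; rewrite mulr_ge0// ltW.
Qed.

(** The trial functions [us] on the guide [t'] become [us \o M^-1] on the guide
    [t]; admissible functions travel in the other direction. *)
Lemma E_F_comp_le (k : nat) :
  (forall X Y : R, (c * X + al * Y) ^+ 2 + (be * Y) ^+ 2 <= X ^+ 2 + Y ^+ 2) ->
  0 < om' <= 1 / 2 -> 0 < om <= 1 / 2 -> c * om' <= om ->
  (E_F om' t' k <= E_F om t k)%E.
Proof.
move=> contr hom' hom comom; have [om'0 _] := andP hom'.
have hG' := Gui_inv c0 be0 hG.
have ci : 0 < c^-1 by rewrite invr_gt0.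
have bi : 0 < be^-1 by rewrite invr_gt0.
pose K := c^-1 * (c^-1 * be^-1).
have K0 : 0 < K by rewrite /K !mulr_gt0.
apply: ge_ereal_sup => _ [us [dus ->]].
pose us' j := us j \o triinv c al be.
have usE j : us j = us' j \o trimap c al be by apply/funext => x; rewrite /us' /= trimapK.
apply: (@le_trans _ _ (ereal_inf [set q | exists (u : R * R -> R[i]) (y : \bar R),
          [/\ domf om t u,
              complex.Re (innerGui t u u) != 0,
              forall d : 'I_k.-1 -> R[i],
                innerGui t (fun x => \sum_(j < k.-1) d j * us' j x) u = 0,
              form_f om t u y
            & q = (y * ((complex.Re (innerGui t u u))^-1)%:E)%E]])); last first.
  apply: ereal_sup_ubound; exists us'; split => // j.
  exact: (domf_comp ci bi hG' om hom' (dus j)).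
apply: le_ereal_inf_tmp => _ [u [y [du nu ou fu ->]]].
have mu : cmeasurable (Gui t : set (mR2 R)) (u : mR2 R -> R[i]) by case: du => -[].
have [y' fy' yy'] := form_comp_le contr (ltW om'0) comom mu fu.
pose v := u \o trimap c al be.
have iv : complex.Re (innerGui t' v v) = K * complex.Re (innerGui t u u).
  by rewrite (innerGui_comp c0 be0 hG) Re_realM.
have N0 : 0 < complex.Re (innerGui t u u) by rewrite lt_def nu Re_innerGui_ge0.
apply: (@le_trans _ _ (y' * ((complex.Re (innerGui t' v v))^-1)%:E)%E).
  apply: ereal_inf_lbound; exists v, y'; split => //.
  - exact: (domf_comp c0 be0 hG om' hom du).
  - by rewrite iv mulf_neq0// gt_eqF.
  - move=> d.
    rewrite (_ : (fun x => _) = (fun x => \sum_(j < k.-1) d j * us' j x) \o trimap c al be);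
      last first.
      by apply/funext => x; apply: eq_bigr => j _; rewrite usE.
    by rewrite (innerGui_comp c0 be0 hG) ou mulr0.
rewrite iv; apply: (@le_trans _ _ (K%:E * y * ((K * complex.Re (innerGui t u u))^-1)%:E)%E).
  by apply: lee_wpmul2r => //; rewrite lee_fin invr_ge0 mulr_ge0 ?ltW.
rewrite [(K%:E * y)%E]muleC -muleA -EFinM invfM mulrA mulfV ?gt_eqF// mul1r.
by [].
Qed.
End comparison.

Section contraction.
Context (R : realType).

(** The left-hand side is the squared length of the gradient of [u \o M] when
    [(X, Y)] is the gradient of [u].  In the frame [S], [T] attached to the axis
    of the target guide, it is [(tau S)^2 + T^2] with [tau] the ratio of the two
    tangents. *)
Lemma trig_contraction (c1 s1 c2 s2 X Y : R) :
  0 < c1 -> 0 < s1 -> 0 < c2 -> 0 < s2 -> c1 ^+ 2 + s1 ^+ 2 = 1 -> c2 ^+ 2 + s2 ^+ 2 = 1 ->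
  s1 * c2 <= s2 * c1 ->
  (c2 / c1 * X + (c2 / c1 * c2 - c1) / s2 * Y) ^+ 2 + (s1 / s2 * Y) ^+ 2 <= X ^+ 2 + Y ^+ 2.
Proof.
move=> c10 s10 c20 s20 e1 e2 le.
pose S := s2 * X + c2 * Y; pose T := c2 * X - s2 * Y; pose tau := s1 * c2 / (s2 * c1).
(* In the orthonormal frame attached to the source guide, the gradient of the
   pulled back function has the components [tau S] and [T]. *)
have -> : c2 / c1 * X + (c2 / c1 * c2 - c1) / s2 * Y = s1 * tau * S + c1 * T.
  have e : s1 ^+ 2 = 1 - c1 ^+ 2 by rewrite -e1; ring.
  have e' : s2 ^+ 2 = 1 - c2 ^+ 2 by rewrite -e2; ring.
  have -> : c1 * T = (c1 ^+ 2 * (c2 * s2 * X) - c1 ^+ 2 * (s2 ^+ 2) * Y) / (s2 * c1).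
    by rewrite /T; field; rewrite !gt_eqF.
  have -> : s1 * tau * S = s1 ^+ 2 * c2 * (s2 * X + c2 * Y) / (s2 * c1).
    by rewrite /S /tau; field; rewrite !gt_eqF.
  by rewrite e e'; field; rewrite !gt_eqF.
have -> : s1 / s2 * Y = c1 * tau * S - s1 * T.
  have -> : s1 / s2 * Y = s1 / s2 * Y * (c2 ^+ 2 + s2 ^+ 2) by rewrite e2 mulr1.
  by rewrite /S /T /tau; field; rewrite !gt_eqF.
have -> : X ^+ 2 + Y ^+ 2 = S ^+ 2 + T ^+ 2.
  rewrite -[LHS]mulr1 -e2 /S /T; ring.
rewrite [leLHS](_ : _ = (c1 ^+ 2 + s1 ^+ 2) * ((tau * S) ^+ 2 + T ^+ 2)); last by ring.
rewrite e1 mul1r lerD2r exprMn ler_piMl ?sqr_ge0//.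
have t0 : 0 <= tau by rewrite /tau divr_ge0// mulr_ge0// ltW.
rewrite -(expr1n _ 2) ler_sqr ?nnegrE//.
by rewrite /tau ler_pdivrMr ?mul1r// mulr_gt0.
Qed.
End contraction.
Unset Implicit Arguments.

Theorem proposition1p4 (R : realType) (theta1 theta2 omega1 omega2 : R)
    (htheta1 : 0 < theta1) (htheta12 : theta1 <= theta2)
    (htheta2 : theta2 < pi / 2)
    (homega1 : 0 < omega1 <= 1 / 2)
    (homega2 : cos theta2 * (cos theta1)^-1 * omega1 <= omega2 <= 1 / 2)
    (k : nat) (hk : (1 <= k)%N) :
  (E_F omega1 theta1 k <= E_F omega2 theta2 k)%E.
Proof.
have p0 := pi_gt0 R.
have ph : pi / 2 < pi :> R by rewrite ltr_pdivrMr// ltr_pMr// ltr1n.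
have trig (th : R) : 0 < th -> th < pi / 2 -> 0 < cos th /\ 0 < sin th.
  move=> h0 h1; split; last by rewrite sin_gt0_pi// h0 (lt_trans h1).
  by rewrite cos_gt0_pihalf// h1 (lt_trans _ h0)// oppr_lt0 divr_gt0.
have htheta1' : theta1 < pi / 2 by exact: le_lt_trans htheta2.
have htheta2' : 0 < theta2 by exact: lt_le_trans htheta12.
have [c10 s10] := trig _ htheta1 htheta1'; have [c20 s20] := trig _ htheta2' htheta2.
set c1 := cos theta1 in homega2 c10 *; set c2 := cos theta2 in homega2 c20 *.
have [q1 q2] := andP homega2; have [w1 w2] := andP homega1.
pose c := c2 / c1; pose al := (c * c2 - c1) / sin theta2; pose be := sin theta1 / sin theta2.
have cc0 : 0 < c by rewrite divr_gt0.
have be0 : 0 < be by rewrite divr_gt0.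
(* The map preserves [r cos th - z sin th] and multiplies [r] by [c]. *)
apply: (@E_F_comp_le R c al be omega2 omega1 theta2 theta1 cc0 be0) => //.
- move=> x; rewrite !GuiE ?htheta1 ?htheta1' ?htheta2 ?htheta2'//.
  rewrite /trimap /= pmulr_rgt0//.
  have -> // : c * x.1 * cos theta2 - (al * x.1 + be * x.2) * sin theta2 =
    x.1 * cos theta1 - x.2 * sin theta1.
  by rewrite /al /be -/c2 -/c1; field; rewrite !gt_eqF.
- move=> X Y; apply: trig_contraction => //; try exact: cos2Dsin2.
  rewrite -subr_ge0 [sin theta1 * _]mulrC -sinB; apply: sin_ge0_pi.
  rewrite subr_ge0 htheta12 /=; lra.
- by rewrite q2 andbT; apply: lt_le_trans q1; rewrite !mulr_gt0 ?invr_gt0.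
Qed.
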